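(* Assume $-y\ge r/(4c)$ and that $h$ is convex and twice continuously differentiable on $[0,D]$. Fix $x\in[0,\beta_0)$. Let $$\tilde\tau=\int_0^{x}\frac{d\xi}{\sqrt{y^2-h(\xi)/c}},$$ let $\omega:[0,\tilde\tau]\to\mathbb{R}$ be the unique $C^1$ solution, with $\omega(0)=0$, of $$\dot\omega(t)=-y-\sqrt{y^2-h\big((x+yt+\omega(t))\wedge x\big)/c},\qquad t\in[0,\tilde\tau],$$ and let $\psi(t)=\big(\frac{c}{c_1}\omega(t),-\frac{c}{c_2}\omega(t)\big)$ for $t\in[0,\tilde\tau]$ (extended to $[\tilde\tau,\infty)$ in an arbitrary continuous way). Then for every $\varrho\in\mathcal{E}$ such that $\varphi_{x,\psi,\varrho}(t)\in[0,D]$ for all $t$ up to the hitting time $\tau(x,\psi,\varrho)$, one has $$\bar c(x,\psi,\varrho)\ge U(x).$$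
   Context: Fixed data: constants $D>0$, $r>0$, $c_1>0$, $c_2>0$, $y\in\mathbb{R}$; $c:=(c_1^{-1}+c_2^{-1})^{-1}$; and a continuous, strictly increasing function $h:[0,D]\to[0,\infty)$ with $h(0)=0$. Under $-y\ge r/(4c)$ define $$\beta_0=\begin{cases}h^{-1}\big(-\tfrac{r^2}{4c}-ry\big), & -h(D)\le \tfrac{r^2}{4c}+ry\le 0,\\ D, & \tfrac{r^2}{4c}+ry<-h(D).\end{cases}$$ (One has $y^2-h(u)/c\ge0$ for $u\in[0,\beta_0]$.) Let $\mathcal{P}$ be the set of continuous functions $[0,\infty)\to\mathbb{R}$ starting at $0$, and $\mathcal{E}$ the set of nondecreasing right-continuous functions with left limits $[0,\infty)\to[0,\infty)$ (a positive value at time $0$ is allowed and is regarded as a jump at time $0$). For $T\ge0$ and $\psi=(\psi^1,\psi^2)\in\mathcal{P}^2$ let $\mathbb{I}(T,\psi)=\int_0^T\big[c_1(\dot\psi^1(s))^2+c_2(\dot\psi^2(s))^2\big]ds$ if $\psi^1,\psi^2$ are absolutely continuous on $[0,T]$, and $\mathbb{I}(T,\psi)=+\infty$ otherwise. Hitting time game. Given $x\in[0,D]$, $\psi\in\mathcal{P}^2$, $\varrho\in\mathcal{E}$, the dynamics are $\varphi_{x,\psi,\varrho}(t)=x+yt+\psi^1(t)-\psi^2(t)-\varrho(t)$, $t\ge0$, and $\tau(x,\psi,\varrho)=\inf\{t\ge0:\varphi_{x,\psi,\varrho}(t)=0\}$ ($\inf\emptyset=\infty$). When $\tau=\tau(x,\psi,\varrho)<\infty$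 and $\varphi_{x,\psi,\varrho}\in[0,D]$ on $[0,\tau]$, the cost is $$\bar c(x,\psi,\varrho)=\int_0^\tau h(\varphi_{x,\psi,\varrho}(t))\,dt+r\varrho(\tau)-\mathbb{I}(\tau,\psi).$$ A strategy is a map $\bar\alpha:\mathcal{P}^2\to\mathcal{E}$ that is causal: for every $t\ge0$, if $\psi=\tilde\psi$ on $[0,t]$ then $\bar\alpha[\psi]=\bar\alpha[\tilde\psi]$ on $[0,t]$. Let $\bar{\mathcal{A}}_x$ be the set of strategies such that for every $\psi\in\mathcal{P}^2$, with $\varrho=\bar\alpha[\psi]$, one has $\varphi_{x,\psi,\varrho}(t)\in[0,D]$ for all finite $t\in[0,\tau(x,\psi,\varrho)]$. Let $\mathcal{Q}[x,\bar\alpha]=\{\psi\in\mathcal{P}^2:\tau(x,\psi,\bar\alpha[\psi])<\infty\}$. The value is $$U(x)=\inf_{\bar\alpha\in\bar{\mathcal{A}}_x}\ \sup_{\psi\in\mathcal{Q}[x,\bar\alpha]}\bar c(x,\psi,\bar\alpha[\psi]).$$ *)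

(* Defs.v *)
From HB Require Import structures.
From mathcomp Require Import all_boot all_order all_algebra.
From mathcomp Require Import all_classical all_reals all_analysis.

Set Implicit Arguments.
Unset Strict Implicit.
Unset Printing Implicit Defensive.

Import Order.TTheory GRing.Theory Num.Theory.
Import numFieldNormedType.Exports.

Local Open Scope classical_set_scope.
Local Open Scope ring_scope.

(* Functions whose mathematical domain is [0, +oo[, [0, D] or [0, T] are total
   functions R -> R here; every notion below reads them on that domain only. *)

Section Calculus.
Context {R : realType}.
Implicit Types (A : set R) (f g : R -> R).

(* The derivative relative to A: one-sided at the end points of an interval,
   vacuous when A is a single point. *)
Definition has_derivative_on A f g : Prop :=
  forall t, A t -> (f s - f t) / (s - t) @[s --> within A (t^')] --> g t.

Definition C1_on A f : Prop :=
  exists2 f1, has_derivative_on A f f1 & {within A, continuous f1}.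

Definition C2_on A f : Prop :=
  exists2 f1, has_derivative_on A f f1 & C1_on A f1.

Definition absolutely_continuous (T : R) f : Prop :=
  forall e : R, 0 < e -> exists2 d : R, 0 < d &
    forall (n : nat) (a b : 'I_n -> R),
      (forall i, [/\ 0 <= a i, a i <= b i & b i <= T]) ->
      trivIset setT (fun i => `]a i, b i[%classic) ->
      \sum_(i < n) (b i - a i) < d ->
      \sum_(i < n) `|f (b i) - f (a i)| < e.

End Calculus.

Section Game.
Context {R : realType}.
Local Notation path2 := ((R -> R) * (R -> R))%type.
Implicit Types (psi : path2) (rho : R -> R) (alpha : path2 -> R -> R).

Definition in_P (f : R -> R) : Prop :=
  {within `[0, +oo[, continuous f} /\ f 0 = 0.

Definition in_P2 psi : Prop := in_P psi.1 /\ in_P psi.2.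

Definition in_E rho : Prop :=
  [/\ forall t, 0 <= t -> 0 <= rho t,
      forall s t, 0 <= s -> s <= t -> rho s <= rho t,
      forall t, 0 <= t -> rho s @[s --> t^'+] --> rho t &
      forall t, 0 < t -> cvg (rho s @[s --> t^'-])].

(* On absolutely continuous paths the two-sided derivative exists almost
   everywhere; where it does not exist, [derive1] has a constant junk value. *)
Definition action (c1 c2 T : R) psi : \bar R :=
  if `[< absolutely_continuous T psi.1 /\ absolutely_continuous T psi.2 >]
  then (\int[lebesgue_measure]_(s in `[0%R, T])
          (c1 * (derive1 psi.1 s) ^+ 2 + c2 * (derive1 psi.2 s) ^+ 2)%:E)%E
  else +oo%E.

Context (D r c1 c2 y : R) (h : R -> R).

Definition cpar : R := (c1^-1 + c2^-1)^-1.

(* The inverse of h is that of its restriction to [0, D]. *)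
Definition beta0 : R :=
  let q := r ^+ 2 / (4 * cpar) + r * y in
  if - h D <= q then 'pinv_(fun=> 0) `[0, D] h (- q) else D.

Definition phi (x : R) psi rho (t : R) : R :=
  x + y * t + psi.1 t - psi.2 t - rho t.

Definition tau (x : R) psi rho : \bar R :=
  ereal_inf [set t%:E | t in [set t : R | 0 <= t /\ phi x psi rho t = 0]].

Definition stays_in (x : R) psi rho : Prop :=
  forall t, 0 <= t -> (t%:E <= tau x psi rho)%E -> 0 <= phi x psi rho t <= D.

(* Meaningful only when the hitting time is finite and [stays_in] holds. *)
Definition cost (x : R) psi rho : \bar R :=
  let T := fine (tau x psi rho) in
  (\int[lebesgue_measure]_(t in `[0%R, T]) (h (phi x psi rho t))%:E
   + (r * rho T)%:E - action c1 c2 T psi)%E.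

(* Causality for all t makes the values of alpha on [0, +oo[ independent of
   the values of psi at negative times. *)
Definition strategy alpha : Prop :=
  (forall psi, in_P2 psi -> in_E (alpha psi)) /\
  (forall psi psi', in_P2 psi -> in_P2 psi' -> forall t, 0 <= t ->
    (forall s, 0 <= s <= t -> psi.1 s = psi'.1 s /\ psi.2 s = psi'.2 s) ->
    forall s, 0 <= s <= t -> alpha psi s = alpha psi' s).

Definition admissible (x : R) : set (path2 -> R -> R) :=
  [set alpha | strategy alpha /\
    forall psi, in_P2 psi -> stays_in x psi (alpha psi)].

Definition Q (x : R) alpha : set path2 :=
  [set psi | in_P2 psi /\ (tau x psi (alpha psi) < +oo)%E].

Definition U (x : R) : \bar R :=
  ereal_inf [set ereal_sup [set cost x psi (alpha psi) | psi in Q x alpha]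
            | alpha in admissible x].

Definition tau_tilde (x : R) : R :=
  \int[lebesgue_measure]_(xi in `[0, x])
    (Num.sqrt (y ^+ 2 - h xi / cpar))^-1.

Definition omega_solution (x : R) (omega : R -> R) : Prop :=
  [/\ C1_on `[0, tau_tilde x] omega, omega 0 = 0 &
      has_derivative_on `[0, tau_tilde x] omega (fun t =>
        - y - Num.sqrt
          (y ^+ 2 - h (Num.min (x + y * t + omega t) x) / cpar))].

End Game.

(* Main.v *)
From HB Require Import structures.
Require Import Defs.
From mathcomp Require Import all_boot all_order all_algebra.
From mathcomp Require Import all_classical all_reals all_analysis.
From mathcomp Require Import measurable_realfun.
From mathcomp Require Import ring lra.

Import Order.TTheory GRing.Theory Num.Theory.
Import numFieldNormedType.Exports.

Local Open Scope classical_set_scope.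
Local Open Scope ring_scope.

(** Both sides of the inequality are compared with one function [V], the primitive of [marginal]
    that vanishes at 0. Here [marginal u] is the smaller root l of the Hamilton-Jacobi equation h(u)
    + l y + l^2/(4c) = 0, with h frozen outside [0, x]. The proof shows U(x) <= V(x) <= cost.

    U(x) <= V(x) ([value_ge_U]): the minimizer keeps the state at or below x by pushing with the
    running maximum of y t + psi.1 - psi.2 ([barrier]). For every psi of finite action, the
    derivative of V(phi) + r rho plus h(phi) is almost everywhere at most the action density
    ([barrier_running_cost_rate]). Below x the control is at rest, and the bound is the
    Hamilton-Jacobi equation combined with Young's inequality [action_density_ge]. At x the state
    has zero velocity, and Young's inequality with multiplier r suffices, since x < beta0 means h(x)
    + r y + r^2/(4c) < 0 ([lt_beta0]). Integrating the rate uses that an absolutely continuous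
    function is the integral of its almost everywhere derivative ([absolutely_continuous_density]),
    obtained from the Jordan decomposition, Stieltjes measures and Radon-Nikodym.

    V(x) <= cost ([value_le_cost]): without control, psi drives the state along a path X with X' =
    -speed(X), from x down to 0 in time S = [tau_tilde]. A control ends the game at some T <= S with
    rho(T) = X(T) = p. Until then phi = X - rho >= X - p, and convexity gives h(phi) >= h(X - p) >=
    h(X) - p h'(X). This bound integrates in closed form ([free_path_payoff]), and the cost is at
    least V(x) + (p marginal(p) - V(p)) + p (r - marginal(x)). Both brackets are nonnegative because
    [marginal] is nondecreasing and at most r. *)

Section Clamp.
Context {R : realType}.

(** Precomposing with [clamp] extends a function given on [a, b] by its end values, so that
    continuity on the interval becomes continuity on all of R. *)
Definition clamp (a b t : R) : R := Num.max a (Num.min b t).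

Lemma clamp_itv a b t : a <= b -> a <= clamp a b t <= b.
Proof. by move=> ab; rewrite /clamp le_max lexx/= ge_max ab ge_min lexx. Qed.

Lemma clampE a b t : a <= t <= b -> clamp a b t = t.
Proof. by move=> /andP[at_ tb]; rewrite /clamp (min_r tb) (max_r at_). Qed.

Lemma clamp_homo a b : {homo clamp a b : s t / s <= t}.
Proof.
move=> s t st; rewrite /clamp ge_max !le_max lexx/= le_min !ge_min lexx/= st.
by rewrite !orbT.
Qed.

Lemma clamp_dist a b s t : `|clamp a b s - clamp a b t| <= `|s - t|.
Proof.
wlog st : s t / s <= t.
  by move=> H; case: (leP s t) => [|/ltW] st; [|rewrite distrC [leRHS]distrC]; exact: H.
rewrite distrC [leRHS]distrC !ger0_norm ?subr_ge0 ?clamp_homo// /clamp.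
by rewrite /Num.max /Num.min; do 4?case: ifP; lra.
Qed.

End Clamp.

                                        

(** * Total variation of an absolutely continuous function *)

Section TotalVariation.
Context {R : realType}.
Implicit Types (f : R -> R) (T e : R).

Lemma absolutely_continuous_finType {T f} {e : R} :
  absolutely_continuous T f -> 0 < e -> exists2 d : R, 0 < d &
    forall (I : finType) (a b : I -> R),
      (forall i, [/\ 0 <= a i, a i <= b i & b i <= T]) ->
      trivIset setT (fun i => `]a i, b i[%classic) ->
      \sum_i (b i - a i) < d ->
      \sum_i `|f (b i) - f (a i)| < e.
Proof.
move=> acf e0; have [d d0 dP] := acf e e0; exists d => // I a b abT triv.
have sumE (F : I -> R) : \sum_i F i = \sum_(i < #|I|) F (enum_val i).
  by rewrite -(big_enum_val F).
rewrite !sumE => abd.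
apply: dP abd => [i|i j _ _ ij]; first exact: abT.
by apply: enum_val_inj; exact: triv ij.
Qed.

Lemma itv_partition_nth_le_nth (a b : R) (s : seq R) i j :
  itv_partition a b s -> (i <= j <= size s)%N ->
  nth b (a :: s) i <= nth b (a :: s) j.
Proof.
move=> [sa _] /andP[ij js].
by rewrite lt_sorted_leq_nth//= inE ltnS // (leq_trans ij).
Qed.

(** Refining disjoint intervals by partitions gives again disjoint intervals of the same total
    length, so the modulus of absolute continuity also controls sums of variations. The partition
    cells are indexed together by the dependent pairs [J]. *)
Lemma absolutely_continuous_variations {T f} {e : R} :
  absolutely_continuous T f -> 0 < e -> exists2 d : R, 0 < d &
    forall (I : finType) (a b : I -> R) (s : I -> seq R),
      (forall i, [/\ 0 <= a i, a i <= b i & b i <= T]) ->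
      trivIset setT (fun i => `]a i, b i[%classic) ->
      \sum_i (b i - a i) < d ->
      (forall i, itv_partition (a i) (b i) (s i)) ->
      \sum_i variation (a i) (b i) f (s i) < e.
Proof.
move=> acf e0; have [d d0 dP] := absolutely_continuous_finType acf e0.
exists d => // I a b s abT triv abd sP.
pose J := {i : I & 'I_(size (s i))}.
pose A (p : J) := nth (b (tag p)) (a (tag p) :: s (tag p)) (tagged p).
pose B (p : J) := nth (b (tag p)) (a (tag p) :: s (tag p)) (tagged p).+1.
have aA p : a (tag p) <= A p.
  by apply: itv_partition_nth_ge => //; rewrite ltnS ltnW// ltn_ord.
have AB p : A p <= B p.
  by apply: itv_partition_nth_le_nth => //; rewrite leqnSn/= ltn_ord.
have Bb p : B p <= b (tag p).
  by apply: itv_partition_nth_le => //; rewrite ltnS.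
have sumE (g : R -> R -> R) :
    \sum_i \sum_(j < size (s i))
      g (nth (b i) (a i :: s i) j.+1) (nth (b i) (a i :: s i) j) =
    \sum_p g (B p) (A p).
  by rewrite sig_big_dep/=.
rewrite [X in X < _](_ : _ = \sum_p `|f (B p) - f (A p)|); last first.
  rewrite -(sumE (fun u v => `|f u - f v|)); apply: eq_bigr => i _.
  by rewrite /variation big_mkord.
apply: dP => [p||].
- have [a0 _ bT] := abT (tag p); split => //; first exact: le_trans (aA p).
  exact: le_trans bT.
- move=> [i j] [k l] _ _ /= [x []]; rewrite /A /B/= !in_itv/=.
  move=> /andP[ix xj] /andP[kx xl].
  have ik : i = k.
    apply: triv => //; exists x; split; rewrite /= in_itv/=; apply/andP; split.
    + exact: le_lt_trans (aA (existT _ i j)) ix.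
    + exact: lt_le_trans xj (Bb (existT _ i j)).
    + exact: le_lt_trans (aA (existT _ k l)) kx.
    + exact: lt_le_trans xl (Bb (existT _ k l)).
  subst k; congr existT; apply/val_inj => /=.
  case: (ltngtP j l) => // jl.
  + have : nth (b i) (a i :: s i) j.+1 <= nth (b i) (a i :: s i) l.
      by apply: itv_partition_nth_le_nth => //; rewrite jl/= ltnW.
    by move=> /(lt_le_trans xj) /(lt_trans kx); rewrite ltxx.
  + have : nth (b i) (a i :: s i) l.+1 <= nth (b i) (a i :: s i) j.
      by apply: itv_partition_nth_le_nth => //; rewrite jl/= ltnW.
    by move=> /(lt_le_trans xl) /(lt_trans ix); rewrite ltxx.
- rewrite -(sumE (fun u v => u - v)).
  rewrite [X in X < _](_ : _ = \sum_i (b i - a i)) //.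
  apply: eq_bigr => i _.
  rewrite -(big_mkord xpredT (fun j => nth (b i) (a i :: s i) j.+1 - nth (b i) (a i :: s i) j)).
  by rewrite telescope_sumr// (itv_partition_nth_size _ (sP i)).
Qed.

Lemma absolutely_continuous_total_variation1 {T f} {e : R} :
  absolutely_continuous T f -> 0 < e -> exists2 d : R, 0 < d &
    forall a b, 0 <= a -> a <= b -> b <= T -> b - a < d ->
      (total_variation a b f <= e%:E)%E.
Proof.
move=> acf e0; have [d d0 dP] := absolutely_continuous_variations acf e0.
exists d => // a b a0 ab bT bad; apply: ge_ereal_sup => _ [_ [s sP <-] <-].
rewrite lee_fin ltW//; have := dP 'I_1 (fun=> a) (fun=> b) (fun=> s).
rewrite !big_ord1; apply => //.
by move=> i j _ _ _; rewrite !ord1.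
Qed.

(** Cut [0, T] into N intervals shorter than the modulus [d] for the error 1: each has variation at
    most 1, so the total is at most N. *)
Lemma absolutely_continuous_bounded_variation {T f} :
  0 <= T -> absolutely_continuous T f -> bounded_variation 0 T f.
Proof.
move=> T0 acf; apply/bounded_variationP => //.
have [d d0 dP] := absolutely_continuous_total_variation1 acf ltr01.
pose N := (Num.bound (T / d)).
have N0 : (0 < N)%N.
  by rewrite -(ltr_nat R) (le_lt_trans _ (archi_boundP _)) ?divr_ge0// ltW.
have TN : T / N%:R < d.
  rewrite ltr_pdivrMr ?ltr0n// mulrC -ltr_pdivrMr//.
  by rewrite archi_boundP ?divr_ge0// ltW.
suff H k : (k <= N)%N -> (total_variation 0 (k%:R * (T / N%:R)) f <= k%:R%:E)%E.
  have := H N (leqnn N); rewrite mulrC divfK ?gt_eqF ?ltr0n// => TVN.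
  by rewrite ge0_fin_numE ?total_variation_ge0// (le_lt_trans TVN)// ltry.
have TN0 : 0 <= T / N%:R by rewrite divr_ge0.
elim: k => [_|k IH kN]; first by rewrite mul0r total_variationxx.
rewrite (@total_variationD _ _ _ (k%:R * (T / N%:R))) ?mulr_ge0//; last first.
  by rewrite ler_wpM2r// ler_nat.
rewrite -[in leRHS]natr1 EFinD leeD ?IH// ?(ltnW kN)//; apply: dP.
- by rewrite mulr_ge0.
- by rewrite ler_wpM2r// ler_nat.
- by rewrite mulrCA ler_piMr// ler_pdivrMr ?ltr0n// mul1r ler_nat.
- by rewrite -mulrBl -natrB// subSnn mul1r.
Qed.

(** Each variation over [a i, b i] is nearly attained by a partition, and
    [absolutely_continuous_variations] bounds the sum over these partitions. *)
Lemma absolutely_continuous_total_variation {T f} :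
  0 <= T -> absolutely_continuous T f ->
  absolutely_continuous T (fun t => fine (total_variation 0 t f)).
Proof.
move=> T0 acf e e0.
have bvf := absolutely_continuous_bounded_variation T0 acf.
have [d d0 dP] := absolutely_continuous_variations acf (divr_gt0 e0 (ltr0n R 2)).
exists d => // n a b abT triv abd.
have BVi u v : 0 <= u -> u <= v -> v <= T -> bounded_variation u v f.
  move=> u0 uv vT; apply: (@bounded_variationr _ 0) => //.
  by apply: (@bounded_variationl _ _ _ T) => //; exact: le_trans uv.
(* The slack e / 2 / (n + 1) per interval adds up to at most e / 2 over the n intervals, also when n
   = 0. *)
have TVs i : exists s, itv_partition (a i) (b i) s /\
    fine (total_variation (a i) (b i) f) <=
      variation (a i) (b i) f s + e / 2 / n.+1%:R.
  have [a0 ab bT] := abT i.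
  have TVfin : total_variation (a i) (b i) f \is a fin_num.
    exact/bounded_variationP/BVi.
  have e0' : 0 < e / 2 / n.+1%:R by rewrite !divr_gt0.
  have [_ [_ [s sP <-] <-] +] := ub_ereal_sup_adherent e0' TVfin.
  rewrite -/(total_variation _ _ _) -[in X in (X < _)%E](fineK TVfin) -EFinD lte_fin => H.
  by exists s; split => //; rewrite -lerBlDr ltW.
have [s sP] := choice TVs.
rewrite (eq_bigr (fun i => fine (total_variation (a i) (b i) f))); last first.
  move=> i _; have [a0 ab bT] := abT i.
  have TVfin u v : 0 <= u -> u <= v -> v <= T -> total_variation u v f \is a fin_num.
    by move=> ? ? ?; exact/bounded_variationP/BVi.
  have b0 : 0 <= b i by exact: le_trans ab.
  have aT : a i <= T by exact: le_trans bT.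
  rewrite (total_variationD f a0 ab) fineD ?TVfin// addrC addKr.
  by rewrite ger0_norm// fine_ge0// total_variation_ge0.
apply: (@le_lt_trans _ _ (\sum_i (variation (a i) (b i) f (s i) + e / 2 / n.+1%:R))).
  by apply: ler_sum => i _; have [] := sP i.
rewrite big_split/= sumr_const card_ord.
have := dP _ a b s abT triv abd (fun i => (sP i).1).
move=> vare; rewrite [ltRHS]splitr ltr_leD//.
rewrite -[leLHS]mulr_natr -mulrA ler_piMr ?divr_ge0 ?ltW//.
by rewrite mulrC ltr_pdivrMr// mul1r ltr_nat.
Qed.

Lemma absolutely_continuous_dist {T f} {e : R} :
  absolutely_continuous T f -> 0 < e -> exists2 d : R, 0 < d &
    forall a b, 0 <= a <= T -> 0 <= b <= T -> `|b - a| < d -> `|f b - f a| < e.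
Proof.
move=> acf e0; have [d d0 dP] := acf e e0; exists d => // a b.
wlog ab : a b / a <= b.
  move=> H aT bT; case: (leP a b) => [|/ltW] ab; first exact: H.
  by rewrite distrC [X in _ -> X < _]distrC; apply: H.
move=> /andP[a0 aT] /andP[b0 bT]; rewrite ger0_norm ?subr_ge0// => abd.
have := dP 1 (fun=> a) (fun=> b); rewrite !big_ord1; apply => //.
by move=> i j _ _ _; rewrite !ord1.
Qed.

Lemma absolutely_continuous_clamp {T f} : 0 <= T ->
  absolutely_continuous T f -> continuous (f \o clamp 0 T).
Proof.
move=> T0 acf t; apply/cvgrPdist_lt => e e0.
have [d d0 dP] := absolutely_continuous_dist acf e0.
near=> s; apply: dP; rewrite ?clamp_itv//.
apply: le_lt_trans (clamp_dist _ _ _ _) _.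
by near: s; apply: cvgr_dist_lt.
Unshelve. all: by end_near. Qed.

End TotalVariation.

(** * Stieltjes measure of small open sets *)

Section MonotoneDensity.
Context {R : realType}.
Notation mu := (@lebesgue_measure R).

Lemma lebesgue_stieltjes_itvoc (F : cumulative R R) (a b : R) : a <= b ->
  lebesgue_stieltjes_measure F `]a, b]%classic = (F b - F a)%:E.
Proof.
move=> ab; rewrite /lebesgue_stieltjes_measure /measure_extension.
by rewrite measurable_mu_extE/= ?wlength_itv_bnd//; exact: is_ocitv.
Qed.

Let step (T : R) n : R := T / (2 ^ n)%:R.
Let cell (T : R) n k : set R := `]k%:R * step T n, k.+1%:R * step T n]%classic.

Let step_gt0 T n : 0 < T -> 0 < step T n.
Proof. by move=> T0; rewrite divr_gt0// ltr0n expn_gt0. Qed.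

Let stepS T n : step T n = 2 * step T n.+1.
Proof. by rewrite /step expnS natrM; field; rewrite ?pnatr_eq0 -?lt0n expn_gt0. Qed.

Let cell_inj T n k l x : 0 < T -> cell T n k x -> cell T n l x -> k = l.
Proof.
move=> T0; rewrite /cell/= !in_itv/= => /andP[kx xk] /andP[lx xl].
have := lt_le_trans kx xl; rewrite ltr_pM2r ?step_gt0// ltr_nat ltnS => kl.
have := lt_le_trans lx xk; rewrite ltr_pM2r ?step_gt0// ltr_nat ltnS => lk.
by apply/eqP; rewrite eqn_leq kl lk.
Qed.

Let cell_exists T n x : 0 < T -> 0 < x <= T ->
  exists2 k, (k < 2 ^ n)%N & cell T n k x.
Proof.
move=> T0 /andP[x0 xT].
have exj : exists j, x <= j%:R * step T n.
  by exists (2 ^ n)%N; rewrite /step mulrC divfK// gt_eqF// ltr0n expn_gt0.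
case: (ex_minnP exj) => -[|j] xj jmin; first by move: xj; rewrite mul0r leNgt x0.
exists j.
  apply: jmin; rewrite /step mulrC divfK// gt_eqF// ltr0n expn_gt0//.
rewrite /cell/= in_itv/= xj andbT ltNge; apply/negP => /jmin.
by rewrite ltnn.
Qed.

Let cellS T n k x : 0 < T -> cell T n k x ->
  exists j, [/\ (j <= (2 * k).+1)%N, cell T n.+1 j x &
    cell T n.+1 j `<=` cell T n k].
Proof.
move=> T0; rewrite /cell/= (stepS T n) in_itv/=.
set s := step T n.+1; have s0 : 0 < s by exact: step_gt0.
have k2 : (2 * k)%:R * s = k%:R * (2 * s) by rewrite natrM; ring.
have k21 : (2 * k).+1%:R * s = k%:R * (2 * s) + s by rewrite -natr1 natrM; ring.
have k22 : (2 * k).+2%:R * s = k.+1%:R * (2 * s).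
  by rewrite -[(2 * k).+2%:R]natr1 -[(2 * k).+1%:R]natr1 -[k.+1%:R]natr1 natrM; ring.
move=> /andP[kx xk]; case: (leP x ((2 * k).+1%:R * s)) => xm.
- exists (2 * k)%N; split => //; first by rewrite in_itv/= xm andbT k2.
  move=> z /=; rewrite !in_itv/= k2 k21 => /andP[-> zk]/=.
  have : k.+1%:R * (2 * s) = k%:R * (2 * s) + 2 * s.
    by rewrite -[k.+1%:R]natr1 mulrDl mul1r.
  by lra.
- exists (2 * k).+1; split => //; first by rewrite in_itv/= xm k22.
  move=> z /=; rewrite !in_itv/= k21 k22 => /andP[kz ->]; rewrite andbT.
  by apply: lt_trans kz; rewrite ltrDl.
Qed.

                                                                              
                                                              
(** The dyadic cells of level n contained in [U] form a finite disjoint family of total length below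
    d, so absolute continuity bounds their F-mass by e. As n grows, their unions increase to a set
    containing the part of [U] in ]0, T], and continuity from below carries the bound over. *)
Lemma absolutely_continuous_open_small (F : cumulative R R) (T e : R) :
  0 < T -> absolutely_continuous T F -> 0 < e -> exists2 d : R, 0 < d &
    forall U, open U -> (mu U < d%:E)%E ->
      (lebesgue_stieltjes_measure F (U `&` `]0%R, T]) <= e%:E)%E.
Proof.
move=> T0 acF e0; have [d d0 dP] := acF e e0; exists d => // U oU Ud.
pose left n (k : 'I_(2 ^ n)) : R := k%:R * step T n.
(* A cell not contained in [U] is collapsed to an empty interval: the index set stays fixed, and the
   cell contributes nothing to either sum. *)
pose right n (k : 'I_(2 ^ n)) : R :=
  if `[<cell T n k `<=` U>] then k.+1%:R * step T n else k%:R * step T n.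
pose I n k : set R := `]left n k, right n k]%classic.
pose V n : set R := \big[setU/set0]_(k < 2 ^ n) I n k.
have IE n k x : I n k x <-> cell T n k x /\ cell T n k `<=` U.
  rewrite /I /right; case: asboolP => kU; split=> [|[]//].
  - by split.
  - by rewrite /= in_itv/= /left => /andP[/lt_le_trans /[apply]]; rewrite ltxx.
have triv n : trivIset setT (I n).
  move=> k l _ _ [x [/IE[kx _] /IE[lx _]]]; apply/val_inj.
  exact: cell_inj kx lx.
have mI n k : measurable (I n k : set (measurableTypeR R)).
  exact: measurable_itv.
have lr n k : left n k <= right n k.
  rewrite /left /right; case: asboolP => // _.
  by rewrite ler_wpM2r ?ler_nat// ltW// step_gt0.
have mV n : measurable (V n : set (measurableTypeR R)).
  exact: bigsetU_measurable.
have VP n x : V n x <-> exists k, I n k x.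
  by rewrite /V -bigcup_pred; split=> [[k _ ?]|[k ?]]; exists k.
have VU n : V n `<=` U.
  by move=> x /VP[k /IE[kx]]; exact.
have FV n : (lebesgue_stieltjes_measure F (V n) <= e%:E)%E.
  rewrite /V measure_bigsetU_ord//.
  rewrite (eq_bigr (fun k => (F (right n k) - F (left n k))%:E)); last first.
    by move=> k _; exact: lebesgue_stieltjes_itvoc.
  rewrite sumEFin lee_fin ltW//.
  rewrite (eq_bigr (fun k => `|F (right n k) - F (left n k)|)); last first.
    by move=> k _; rewrite ger0_norm// subr_ge0 cumulative_is_nondecreasing.
  apply: dP => [k||].
  - split => //; first by rewrite mulr_ge0// ltW// step_gt0.
    apply: (@le_trans _ _ (k.+1%:R * step T n)).
      rewrite /right; case: asboolP => // _.
      by rewrite ler_wpM2r ?ler_nat// ltW// step_gt0.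
    rewrite /step mulrCA; apply: ler_piMr; first exact: ltW.
    by rewrite ler_pdivrMr ?ltr0n ?expn_gt0// mul1r ler_nat.
  - move=> k l _ _ [x [xk xl]]; apply: (triv n) => //; exists x.
    by split; apply: subset_itv_oo_oc.
  - rewrite -lte_fin -sumEFin.
    apply: le_lt_trans Ud.
    apply: le_trans (le_measure mu _ _ (VU n)); rewrite ?inE//; last first.
      exact: open_measurable.
    rewrite /V measure_bigsetU_ord//; apply: lee_sum => k _.
    (* Lebesgue measure is used here as the Stieltjes measure of the identity. *)
    by rewrite [leRHS](lebesgue_stieltjes_itvoc idfun).
have ndV : nondecreasing_seq V.
  apply/nondecreasing_seqP => n; apply/subsetPset => x /VP[k /IE[xk kU]].
  have [j [jk2 xj jk]] := cellS _ _ _ _ T0 xk.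
  have jn : (j < 2 ^ n.+1)%N.
    by rewrite expnS (leq_ltn_trans jk2)// -add2n -mulnS leq_pmul2l ?ltn_ord.
  by apply/VP; exists (Ordinal jn); apply/IE; split => //; exact: subset_trans kU.
have VT : U `&` `]0, T]%classic `<=` \bigcup_n V n.
  move=> x [Ux /=]; rewrite in_itv/= => xT.
  have /nbhs_ballP[r /= r0 xrU] : nbhs x U by exact: open_nbhs_nbhs.
  have [n nr] : exists n, step T n < r.
    exists (Num.bound (T / r)); rewrite /step ltr_pdivrMr ?ltr0n ?expn_gt0//.
    rewrite mulrC -ltr_pdivrMr//.
    apply: (lt_trans (archi_boundP _)); first by rewrite divr_ge0// ltW.
    by rewrite ltr_nat ltn_expl.
  have [k kn kx] := cell_exists _ n _ T0 xT.
  exists n => //; apply/VP; exists (Ordinal kn); apply/IE; split => //= z; move: kx.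
  rewrite /cell/= -[k.+1%:R]natr1 mulrDl mul1r; move: nr.
  set u := k%:R * _; set s := step T n => sr; rewrite !in_itv/= => /andP[? ?] /andP[? ?].
  by apply: xrU; rewrite /ball/= ltr_norml; apply/andP; split; lra.
have mVT : measurable (\bigcup_n V n : set (measurableTypeR R)).
  exact: bigcup_measurable.
apply: (@le_trans _ _ (lebesgue_stieltjes_measure F (\bigcup_n V n))).
  apply: le_measure; rewrite ?inE//; apply: measurableI => //.
  exact: open_measurable.
have := nondecreasing_cvg_mu (mu := lebesgue_stieltjes_measure F) mV mVT ndV.
move=> cV; rewrite -(cvg_lim _ cV)//; apply: lime_le.
  by apply/cvg_ex; eexists; exact: cV.
by apply: nearW => n /=.
Qed.

End MonotoneDensity.

(** * Absolutely continuous functions as integrals of their derivatives *)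

Section Density.
Context {R : realType}.
Notation mu := (@lebesgue_measure R).
Implicit Types (f g : R -> R).

Lemma absolutely_continuous_ext {f g} {T : R} :
  (forall t, 0 <= t <= T -> f t = g t) ->
  absolutely_continuous T f -> absolutely_continuous T g.
Proof.
move=> fg acf e e0; have [d d0 dP] := acf e e0; exists d => // n a b abT triv abd.
rewrite (eq_bigr (fun i => `|f (b i) - f (a i)|)); first exact: dP.
move=> i _; have [a0 ab bT] := abT i.
by rewrite !fg// ?a0 ?bT ?(le_trans ab)// ?(le_trans a0)//.
Qed.

(** Outer regularity encloses a Lebesgue-null set in an open set of small measure, whose F-mass on
    ]0, T] is then small. *)
Lemma absolutely_continuous_null_dominates (F : cumulative R R) (T : R)
  (mT : measurable (`]0, T]%classic : set (measurableTypeR R)))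
  (fT : (lebesgue_stieltjes_measure F `]0%R, T]%classic < +oo)%E) :
  0 < T -> absolutely_continuous T F -> mfrestr mT fT `<< mu.
Proof.
move=> T0 acF; apply/null_content_dominatesP => N mN N0.
apply/eqP; rewrite eq_le measure_ge0 andbT; apply/lee_addgt0Pr => e e0.
have [d d0 dP] := absolutely_continuous_open_small F T e T0 acF e0.
have [|U [oU NU UNd]] := lebesgue_regularity_outer mN _ d0; first by rewrite N0.
rewrite add0e; apply: (@le_trans _ _ (lebesgue_stieltjes_measure F (U `&` `]0, T]%classic))).
  rewrite /mfrestr/= /mrestr; apply: le_measure; rewrite ?inE; [| |exact: setSI].
  - exact: measurableI.
  - by apply: measurableI => //; exact: open_measurable.
apply: dP => //; apply: le_lt_trans UNd.
have mU : measurable (U : set (measurableTypeR R)) by exact: open_measurable.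
rewrite -[X in (mu X <= _)%E](setDKU NU) (le_trans (measureU2 _ _ _))//=.
  exact: measurableD.
by rewrite N0 adde0.
Qed.

(** [g] is the Radon-Nikodym density of the Stieltjes measure of [G] restricted to ]0, T]. *)
Lemma nondecreasing_density {G : R -> R} {T : R} : 0 < T ->
  absolutely_continuous T G -> {in `[0, T] &, {homo G : s t / s <= t}} ->
  exists2 g : R -> R, mu.-integrable setT (EFin \o g) &
    forall t, 0 <= t <= T ->
      (\int[mu]_(u in `[0%R, t]) (g u)%:E = (G t - G 0)%:E)%E.
Proof.
move=> T0 acG ndG.
(* Continuing [G] by constants outside [0, T] gives a cumulative function on R. *)
pose Gc := G \o clamp 0 T.
have ndGc : {homo Gc : s t / s <= t}.
  move=> s t st; apply: ndG; rewrite ?in_itv/= ?clamp_itv ?(ltW T0)//.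
  exact: clamp_homo.
have rcGc : right_continuous Gc.
  by apply/right_continuousW/absolutely_continuous_clamp => //; exact: ltW.
pose F : cumulative R R := HB.pack Gc (isCumulative.Build _ _ _ Gc ndGc rcGc).
have acF : absolutely_continuous T F.
  by apply: absolutely_continuous_ext acG => t tT; rewrite /= /Gc/= clampE.
have mT : measurable (`]0, T]%classic : set (measurableTypeR R)).
  exact: measurable_itv.
have fT : (lebesgue_stieltjes_measure F `]0%R, T]%classic < +oo)%E.
  by rewrite lebesgue_stieltjes_itvoc ?ltW// ltry.
have [g [_ gfin ig gE]] := radon_nikodym_sigma_finite
  (absolutely_continuous_null_dominates F T mT fT T0 acF).
exists (fine \o g).
  by rewrite (_ : EFin \o _ = g)//; apply/funext => x /=; rewrite fineK.
move=> t /andP[t0 tT].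
under eq_integral do rewrite /= fineK//.
rewrite -gE; last exact: measurable_itv.
transitivity (lebesgue_stieltjes_measure F (`[0, t]%classic `&` `]0, T]%classic)) => //.
rewrite (_ : _ `&` _ = `]0, t]%classic).
  rewrite lebesgue_stieltjes_itvoc//= /Gc/= !clampE//.
    by rewrite lexx ltW.
  by rewrite t0.
apply/seteqP; split=> x /=; rewrite !in_itv/=.
  by move=> [/andP[_ ->] /andP[-> _]].
by move=> /andP[x0 xt]; rewrite (ltW x0) xt x0 (le_trans xt).
Qed.

(** Shaped for running maxima, whose increment over an interval is bounded by an increment of the
    original function over a subinterval. *)
Lemma absolutely_continuous_sub_itv {f} g {T : R} :
  (forall a b, 0 <= a -> a <= b -> b <= T ->
    exists a' b', [/\ a <= a', a' <= b', b' <= b & `|g b - g a| <= `|f b' - f a'|]) ->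
  absolutely_continuous T f -> absolutely_continuous T g.
Proof.
move=> gf acf e e0; have [d d0 dP] := acf e e0; exists d => // n a b abT triv abd.
have ab' i : exists p : R * R, [/\ a i <= p.1, p.1 <= p.2, p.2 <= b i &
    `|g (b i) - g (a i)| <= `|f p.2 - f p.1|].
  have [a0 ab bT] := abT i; have [a' [b' H]] := gf _ _ a0 ab bT.
  by exists (a', b').
have [p pP] := choice ab'.
apply: (@le_lt_trans _ _ (\sum_(i < n) `|f (p i).2 - f (p i).1|)).
  by apply: ler_sum => i _; have [] := pP i.
apply: dP => [i|i j _ _ [x []]|].
- have [a0 ab bT] := abT i; have [? ? ? _] := pP i; split => //.
    exact: le_trans a0 _.
  exact: le_trans bT.
- rewrite /= !in_itv/= => /andP[xi ix] /andP[xj jx]; apply: triv => //.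
  have [? ? ? _] := pP i; have [? ? ? _] := pP j.
  exists x; split; rewrite /= in_itv/=; apply/andP; split; lra.
- apply: le_lt_trans abd; apply: ler_sum => i _.
  by have [? ? ? _] := pP i; lra.
Qed.

Lemma absolutely_continuous_lipschitz {f} g (C : R) {T : R} :
  (forall s t, 0 <= s <= T -> 0 <= t <= T -> `|g t - g s| <= C * `|f t - f s|) ->
  absolutely_continuous T f -> absolutely_continuous T g.
Proof.
move=> gf acf e e0.
pose K := `|C| + 1; have K0 : 0 < K by rewrite ltr_wpDl.
have [d d0 dP] := acf (e / K) (divr_gt0 e0 K0).
exists d => // n a b abT triv abd.
have := dP n a b abT triv abd; rewrite ltr_pdivlMr// mulr_suml.
apply: le_lt_trans; apply: ler_sum => i _; have [a0 ab bT] := abT i.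
apply: le_trans (gf _ _ _ _) _; rewrite ?a0 ?bT ?(le_trans ab)// ?(le_trans a0)//.
rewrite mulrC ler_wpM2l// (le_trans (ler_norm _))// lerDl//.
Qed.

Lemma absolutely_continuous_id (T : R) : absolutely_continuous T (@idfun R).
Proof.
move=> e e0; exists e => // n a b abT _ abe.
rewrite (eq_bigr (fun i => b i - a i))// => i _.
by have [_ ab _] := abT i; rewrite ger0_norm// subr_ge0.
Qed.

Lemma absolutely_continuousD {f g} {T : R} :
  absolutely_continuous T f -> absolutely_continuous T g ->
  absolutely_continuous T (f \+ g).
Proof.
move=> acf acg e e0.
have e20 : 0 < e / 2 by rewrite divr_gt0.
have [d d0 dP] := acf _ e20; have [c c0 cP] := acg _ e20.
exists (Num.min c d); first by rewrite lt_min c0 d0.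
move=> n a b abT triv; rewrite lt_min => /andP[abc abd].
have fe := dP n a b abT triv abd; have ge := cP n a b abT triv abc.
rewrite [e]splitr; apply: le_lt_trans (ltrD fe ge).
rewrite -big_split/=; apply: ler_sum => i _.
by rewrite opprD addrACA ler_normD.
Qed.

Lemma absolutely_continuousN {f} {T : R} :
  absolutely_continuous T f -> absolutely_continuous T (\- f).
Proof.
apply: (@absolutely_continuous_lipschitz _ _ 1) => s t _ _ /=.
by rewrite mul1r -opprD normrN.
Qed.

(** Jordan decomposition: with p the variation function of f, both p and p - f are nondecreasing and
    absolutely continuous, so each has a density and f has their difference. Lebesgue
    differentiation identifies it with the derivative almost everywhere. *)
Lemma absolutely_continuous_density {f} {T : R} : 0 < T ->
  absolutely_continuous T f -> exists g : R -> R,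
  [/\ mu.-integrable setT (EFin \o g),
      forall t, 0 <= t <= T ->
        (\int[mu]_(u in `[0%R, t]) (g u)%:E = (f t - f 0)%:E)%E &
      {ae mu, forall t, 0 < t < T -> is_derive t 1 f (g t)}].
Proof.
move=> T0 acf.
have T0' := ltW T0.
have acTV := absolutely_continuous_total_variation T0' acf.
have bvf := absolutely_continuous_bounded_variation T0' acf.
pose p t := fine (total_variation 0 t f).
have acq : absolutely_continuous T (p \+ (\- f)).
  by apply: absolutely_continuousD => //; exact: absolutely_continuousN.
have TVfin u v : 0 <= u -> u <= v -> v <= T -> total_variation u v f \is a fin_num.
  move=> u0 uv vT; apply/bounded_variationP => //.
  apply: (@bounded_variationr _ 0) => //.
  by apply: (@bounded_variationl _ _ _ T) => //; exact: le_trans uv.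
have pD u v : 0 <= u -> u <= v -> v <= T ->
    p v = p u + fine (total_variation u v f).
  move=> u0 uv vT; rewrite /p (total_variationD f u0 uv) fineD ?TVfin//.
  exact: le_trans vT.
have ndp : {in `[0, T] &, {homo p : s t / s <= t}}.
  move=> u v; rewrite !in_itv/= => /andP[u0 uT] /andP[v0 vT] uv.
  by rewrite (pD u v)// lerDl fine_ge0// total_variation_ge0.
have ndq : {in `[0, T] &, {homo (p \+ (\- f)) : s t / s <= t}}.
  move=> u v; rewrite !in_itv/= => /andP[u0 uT] /andP[v0 vT] uv.
  have : f v - f u <= fine (total_variation u v f).
    rewrite -lee_fin fineK ?TVfin//; apply: le_trans (total_variation_ge _ uv).
    by rewrite lee_fin ler_norm.
  by have := pD u v u0 uv vT => /=; lra.
have [g ig gE] := nondecreasing_density T0 acTV ndp.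
have [k ik kE] := nondecreasing_density T0 acq ndq.
have igk : mu.-integrable setT (EFin \o (g \- k)).
  rewrite (_ : EFin \o _ = (EFin \o g) \- (EFin \o k))%E//.
  exact: integrableB.
have gkE t : 0 <= t <= T ->
    (\int[mu]_(u in `[0%R, t]) ((g \- k) u)%:E = (f t - f 0)%:E)%E.
  move=> tT; rewrite integralB_EFin//; last 2 first.
  - exact: integrableS ig.
  - exact: integrableS ik.
  by rewrite gE// kE// -EFinB; congr EFin; rewrite /= /p; ring.
exists (g \- k); split => //.
have igky y : mu.-integrable [set` Interval (BLeft 0) (BRight y)] (EFin \o (g \- k)).
  exact: integrableS igk.
have lgk : locally_integrable [set: R] (g \- k).
  by apply: open_integrable_locally => //; exact: openT.
have := FTC1 igky lgk; apply: filterS; first exact: (ae_filter_ringOfSetsType mu).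
move=> t + /andP[t0 tT]; move=> /(_ t0) [dF F'].
pose I x := (\int[mu]_(u in [set` Interval (BLeft 0) (BRight x)]) (g \- k) u)%R.
have dI : is_derive t 1 (I + cst (f 0)) (g t - k t).
  rewrite -[g t - k t]addr0; apply: is_deriveD.
  by rewrite derive1E in F'; exact: (DeriveDef dF F').
apply: near_eq_is_derive dI; near=> x.
rewrite /I/Rintegral fctE gkE ?subrK//; apply/andP; split.
  by apply/ltW; near: x; exact: lt_nbhsr.
by apply/ltW; near: x; exact: lt_nbhsl.
Unshelve. all: by end_near. Qed.

End Density.

                                  

(** * Derivatives, comparison of integrals, convexity *)

Section Calculus.
Context {R : realType}.
Notation mu := (@lebesgue_measure R).
Implicit Types (f g u : R -> R).

Lemma is_derive_dist u (t d : R) :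
  is_derive t 1 u d <-> forall e : R, 0 < e -> exists2 k : R, 0 < k &
    forall s, `|s - t| < k -> `|u s - u t - d * (s - t)| <= e * `|s - t|.
Proof.
have quot s : s != t -> forall e, 
    (`|d - (s - t)^-1 * (u s - u t)| <= e) = (`|u s - u t - d * (s - t)| <= e * `|s - t|).
  move=> st e; have st0 : s - t != 0 by rewrite subr_eq0.
  rewrite -ler_pdivrMr ?normr_gt0// -normfV -normrM.
  by congr (_ <= _); rewrite distrC; congr (`| _ |); field.
split=> [[du du'] e e0|H].
- have : h^-1 *: (u (h *: 1 + t) - u t) @[h --> 0^'] --> d by rewrite -du'.
  move=> /cvgrPdist_le/(_ e e0) [k /= k0 kP]; exists k => // s stk.
  have [->|st] := eqVneq s t; first by rewrite !subrr mulr0 subrr normr0 mulr0.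
  rewrite -quot//; have := kP (s - t).
  rewrite /= sub0r normrN subr_eq0 => /(_ stk st).
  by rewrite [_ *: 1]mulr1 subrK.
- have Hd : h^-1 *: (u (h *: 1 + t) - u t) @[h --> 0^'] --> d.
    apply/cvgrPdist_le => e e0; have [k k0 kP] := H e e0.
    exists k => //= h /=; rewrite sub0r normrN => hk h0.
    have ht : h + t != t by rewrite -subr_eq0 addrK.
    rewrite [_ *: 1]mulr1; have := quot _ ht e; rewrite addrK => ->.
    by have := kP (h + t); rewrite addrK; apply.
  by apply: DeriveDef; [apply/cvg_ex; exists d|exact: cvg_lim].
Qed.

Lemma is_derive_unique u (t d d' : R) :
  is_derive t 1 u d -> is_derive t 1 u d' -> d = d'.
Proof. by move=> ? ?; rewrite -(@derive_val _ _ _ _ _ u d) derive_val. Qed.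

Lemma is_derive_local_min0 u (t d : R) :
  is_derive t 1 u d -> u t = 0 -> (\forall s \near t, 0 <= u s) -> d = 0.
Proof.
move=> /is_derive_dist du ut [k /= k0 kP]; apply/eqP/negP => d0.
have d0' : 0 < `|d| / 2 by rewrite divr_gt0// normr_gt0; exact/negP.
have [l l0 lP] := du _ d0'.
(* Moving from t by m against the sign of d changes the linear part by -|d| m, with an error of at
   most |d| m / 2, so u would become negative. *)
pose m := Num.min k l / 2.
have m0 : 0 < m by rewrite divr_gt0// lt_min k0.
have mk : m < k by rewrite /m; case: (leP k l) => ?; lra.
have ml : m < l by rewrite /m; case: (leP k l) => ?; lra.
have Nm : `|Num.sg d * m| = m.
  by rewrite normrM normr_sg (introN idP d0) mul1r gtr0_norm.
have us : 0 <= u (t - Num.sg d * m) by apply: kP; rewrite /= subKr Nm.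
have stE : t - Num.sg d * m - t = - (Num.sg d * m) by rewrite addrAC subrr add0r.
have := lP (t - Num.sg d * m); rewrite stE normrN Nm ut subr0 => /(_ ml).
have -> : d * - (Num.sg d * m) = - (`|d| * m) by rewrite normrEsg; ring.
rewrite opprK.
by move=> /(le_trans (ler_norm _)); nra.
Qed.
Lemma within_clamp_continuous f (a b : R) : a <= b ->
  {within `[a, b], continuous f} -> continuous (f \o clamp a b).
Proof.
move=> ab cf t; apply/cvgrPdist_lt => e e0.
have ct : `[a, b]%classic (clamp a b t) by rewrite /= in_itv/= clamp_itv.
have /subspace_continuousP/(_ _ ct)/cvgrPdist_lt/(_ e e0)[k /= k0 kP] := cf.
near=> s; apply: kP; last by rewrite /= in_itv/= clamp_itv.
apply: le_lt_trans (clamp_dist _ _ _ _) _.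
by near: s; apply: cvgr_dist_lt.
Unshelve. all: by end_near. Qed.

(** The base point -1 makes 0 an interior point, so the primitive has a two-sided derivative
    there. *)
Lemma continuous_primitive f : continuous f ->
  exists2 F : R -> R, F 0 = 0 & forall t : R, -1 < t -> is_derive t 1 F (f t).
Proof.
move=> cf; pose I x := (\int[mu]_(u in [set` `[-1, x]]) f u)%R.
exists (fun x => I x - I 0); first by rewrite subrr.
move=> t t1; rewrite -[f t]subr0; apply: is_deriveB.
have fI : mu.-integrable `[-1, t + 1] (EFin \o f).
  apply: continuous_compact_integrable; first exact: segment_compact.
  exact: continuous_subspaceT.
have tt1 : t < t + 1 by rewrite ltrDl.
have [dI I'] := continuous_FTC1_closed tt1 fI t1 (cf t).
by rewrite derive1E in I'; exact: (DeriveDef dI I').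
Qed.

Lemma has_derivative_on_is_derive f g (a b t : R) :
  has_derivative_on `[a, b] f g -> a < t < b -> is_derive t 1 f (g t).
Proof.
move=> fg /andP[at_ tb]; apply/is_derive_dist => e e0.
have : `[a, b]%classic t by rewrite /= in_itv/= !ltW.
move=> /fg /cvgrPdist_le/(_ e e0) [k /= k0 kP].
exists (Num.min k (Num.min (t - a) (b - t))).
  by rewrite !lt_min k0 !subr_gt0 at_ tb.
move=> s; rewrite !lt_min => /and3P[sk sa sb].
have [->|st] := eqVneq s t; first by rewrite !subrr mulr0 subrr normr0 mulr0.
have := kP s; rewrite /= distrC => /(_ sk st).
rewrite in_itv/= => /(_ _)/wrap[].
  by move: sa sb; rewrite !ltr_norml; lra.
have st0 : s - t != 0 by rewrite subr_eq0.
rewrite -(ler_pM2r (x := `|s - t|)) ?normr_gt0// -normrM.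
by apply: le_trans; rewrite distrC mulrBl divfK// lexx.
Qed.

Lemma has_derivative_on_within_continuous f g (a b : R) :
  has_derivative_on `[a, b] f g -> {within `[a, b], continuous f}.
Proof.
move=> fg; apply/subspace_continuousP => t tab; apply/cvgrPdist_le => e e0.
have /fg /cvgrPdist_le/(_ 1 ltr01) [k /= k0 kP] := tab.
pose C := 1 + `|g t|; have C0 : 0 < C by rewrite ltr_pwDl.
exists (Num.min k (e / C)); first by rewrite /= lt_min k0 divr_gt0.
move=> s /=; rewrite lt_min distrC => /andP[sk se] sab.
have [->|st] := eqVneq s t; first by rewrite subrr normr0 ltW.
have := kP s; rewrite /= distrC => /(_ sk st sab).
have st0 : s - t != 0 by rewrite subr_eq0.
move=> H; rewrite distrC -[f s - f t](divfK st0) normrM.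
have : `|(f s - f t) / (s - t)| <= C.
  by rewrite -[_ / _](subrK (g t)) (le_trans (ler_normD _ _))// lerD2r distrC.
move=> H2; apply: (@le_trans _ _ (C * `|s - t|)); first by rewrite ler_wpM2r.
by rewrite mulrC -ler_pdivlMr// ltW.
Qed.

Lemma continuous_FTC2_is_derive f F (a b : R) : a <= b ->
  {within `[a, b], continuous f} -> {within `[a, b], continuous F} ->
  (forall t : R, a < t < b -> is_derive t 1 F (f t)) ->
  (\int[mu]_(t in `[a, b]) (f t)%:E = (F b - F a)%:E)%E.
Proof.
rewrite le_eqVlt => /predU1P[<-{b} _ _ _|ab cf cF dF].
  by rewrite set_itv1 integral_set1 subrr.
rewrite (continuous_FTC2 ab (F := F)) ?EFinB//.
- have /(continuous_within_itvP _ ab)[_ cFa cFb] := cF.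
  by split => // t; rewrite in_itv/= => /dF [].
- by move=> t; rewrite in_itv/= => /dF; rewrite derive1E => -[].
Qed.

Lemma is_derive_cst_slope f (k a b : R) : a <= b ->
  {within `[a, b], continuous f} ->
  (forall t : R, a < t < b -> is_derive t 1 f k) -> f b - f a = k * (b - a).
Proof.
rewrite le_eqVlt => /predU1P[<-|ab] cf df; first by rewrite !subrr mulr0.
have df' (t : R) : t \in `]a, b[ -> is_derive t 1 f ((fun=> k) t).
  by rewrite in_itv/=; exact: df.
by have [s _ ->] := MVT ab df' cf.
Qed.

Lemma is_derive_ge0_le f g (a b : R) : a <= b ->
  {within `[a, b], continuous f} ->
  (forall t : R, a < t < b -> is_derive t 1 f (g t)) ->
  (forall t : R, a < t < b -> 0 <= g t) -> f a <= f b.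
Proof.
rewrite le_eqVlt => /predU1P[<-//|ab] cf df g0.
have df' (t : R) : t \in `]a, b[ -> is_derive t 1 f (g t).
  by rewrite in_itv/=; exact: df.
have [c cab fE] := MVT ab df' cf.
rewrite -subr_ge0 fE mulr_ge0 ?subr_ge0 ?(ltW ab)//.
by apply: g0; rewrite in_itv/= in cab.
Qed.

Lemma is_derive_gt0_lt f g (a b : R) : a < b ->
  {within `[a, b], continuous f} ->
  (forall t : R, a < t < b -> is_derive t 1 f (g t)) ->
  (forall t : R, a < t < b -> 0 < g t) -> f a < f b.
Proof.
move=> ab cf df g0.
have df' (t : R) : t \in `]a, b[ -> is_derive t 1 f (g t).
  by rewrite in_itv/=; exact: df.
have [c cab fE] := MVT ab df' cf.
rewrite -subr_gt0 fE mulr_gt0 ?subr_gt0//.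
by apply: g0; rewrite in_itv/= in cab.
Qed.

Lemma ae_neq (a : R) : {ae mu, forall t, t <> a}.
Proof.
exists [set a]; split; [exact: measurable_set1|exact: lebesgue_measure_set1|].
by move=> t /= /contrapT.
Qed.

                                                                        
                                                                 
(** Measurability of [g] is not assumed, since the action integrand contains [derive1] of arbitrary
    paths. The integral of a nonnegative [g] is a supremum over simple functions below it, and off a
    null set the positive part of [f] lies below [g]. *)
Lemma le_integral_nonneg_ae (D : set R) f g :
  measurable (D : set (measurableTypeR R)) ->
  mu.-integrable D (EFin \o f) -> (forall t, D t -> 0 <= g t) ->
  {ae mu, forall t, D t -> f t <= g t} ->
  (\int[mu]_(t in D) (f t)%:E <= \int[mu]_(t in D) (g t)%:E)%E.
Proof.
move=> mD fI g0 [N [mN N0 NP]].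
have mf : measurable_fun D (EFin \o f) by case/integrableP: fI.
apply: (@le_trans _ _ (\int[mu]_(t in D) ((EFin \o f)^\+ t))%E).
  rewrite integralE -[leRHS]sube0 leeB//.
  by apply: integral_ge0 => t _; exact: funeneg_ge0.
rewrite (ge0_negligible_integral mN mD)//; last exact: measurable_funepos.
rewrite !ge0_integralE//.
apply: ge_ereal_sup => _ [k kf <-]; apply: ereal_sup_ubound; exists k => // t.
apply: le_trans (kf t) _; rewrite !patchE; case: ifPn => [|_]; last first.
  by case: ifPn => // /set_mem; rewrite lee_fin; exact: g0.
move=> /set_mem[Dt Nt]; rewrite (mem_set Dt) funeposE ge_max !lee_fin g0// andbT.
by apply: contrapT => ftg; apply/Nt/NP => /(_ Dt).
Qed.
(** Convexity bounds f(u - l p) by l f(u - p) + (1 - l) f(u), while differentiability makes f(u - l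
    p) close to f(u) - l p d. One small [l] per error [e] is enough to compare the two and divide by
    [l]. *)
Lemma convex_tangent_le (D : R) f (u p d : R) :
  convex_function (E := R^o) `[0, D]%classic f ->
  0 <= p -> 0 <= u - p -> u <= D -> is_derive u 1 f d ->
  f u - p * d <= f (u - p).
Proof.
rewrite le_eqVlt => cf /predU1P[<- _ _ _|p0 up uD /is_derive_dist df].
  by rewrite mul0r !subr0.
have uu : 0 <= u by lra.
apply/ler_addgt0Pr => e e0; have ep0 : 0 < e / p by rewrite divr_gt0.
have [k k0 kP] := df _ ep0.
pose l := Num.min 1 (k / p / 2).
have l0 : 0 < l by rewrite lt_min ltr01 !divr_gt0.
have l1 : l <= 1 by rewrite ge_min lexx.
have lk : l * p < k.
  have lkp : l <= k / p / 2 by rewrite ge_min lexx orbT.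
  have kpE : k / p / 2 * p = k / 2 by field; rewrite gt_eqF.
  by have := ler_wpM2r (ltW p0) lkp; rewrite kpE; lra.
have uD' : (u : convex_lmodType R^o) \in `[0, D]%classic.
  by rewrite inE/= in_itv/= uu uD.
have upD : (u - p : convex_lmodType R^o) \in `[0, D]%classic.
  by rewrite inE/= in_itv/= up/=; lra.
have := cf (Itv01 (ltW l0) l1) _ _ upD uD'.
have convE (a b : R) : conv (Itv01 (ltW l0) l1) (a : convex_lmodType R^o) b =
    l * a + (1 - l) * b by [].
rewrite convE (_ : l * (u - p) + (1 - l) * u = u - l * p); last by ring.
rewrite [X in _ <= X](_ : _ = l * f (u - p) + (1 - l) * f u) // => fc.
have := kP (u - l * p); rewrite addrAC subrr add0r normrN.
have lp0 : 0 <= l * p by rewrite mulr_ge0// ltW.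
rewrite (ger0_norm lp0) => /(_ lk); rewrite ler_norml => /andP[+ _].
have -> : e / p * (l * p) = l * e by field; rewrite gt_eqF.
move=> fd; rewrite -(ler_pM2l l0); lra.
Qed.

End Calculus.

                            

(** * Running maxima of continuous functions *)

Section RunningMax.
Context {R : realType}.

Definition running_max (F : R -> R) (t : R) : R := sup (F @` `[0, t]).

Context (F : R -> R) (cF : {within `[0, +oo[, continuous F}).
Notation M := (running_max F).

Let cFt (a b : R) : 0 <= a -> {within `[a, b], continuous F}.
Proof.
move=> a0; apply: continuous_subspaceW cF => s /=.
by rewrite !in_itv/= andbT => /andP[/(le_trans a0)].
Qed.

Lemma running_max_arg (t : R) : 0 <= t ->
  exists2 s, 0 <= s <= t & M t = F s /\ forall u, 0 <= u <= t -> F u <= M t.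
Proof.
move=> t0; have [s st sP] := EVT_max t0 (cFt 0 t (lexx _)).
have ME : M t = F s.
  apply/eqP; rewrite eq_le; apply/andP; split.
  - apply: ge_sup; first by exists (F s); exists s.
    by move=> _ [u ut <-]; exact: sP.
  - apply: ub_le_sup; last by exists s.
    by exists (F s) => _ [u ut <-]; exact: sP.
exists s; first by move: st; rewrite in_itv.
by split=> // u ut; rewrite ME; apply: sP; rewrite in_itv.
Qed.

Lemma le_running_max (s t : R) : 0 <= s <= t -> F s <= M t.
Proof.
move=> /[dup] st /andP[s0 /(le_trans s0) t0].
by have [u _ [_]] := running_max_arg t t0; apply.
Qed.

Lemma running_max_homo (s t : R) : 0 <= s -> s <= t -> M s <= M t.
Proof.
move=> s0 st; have [u /andP[u0 us] [-> _]] := running_max_arg s s0.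
by apply: le_running_max; rewrite u0 (le_trans us).
Qed.

Lemma running_max0 : M 0 = F 0.
Proof.
have [s] := running_max_arg 0 (lexx _).
by rewrite -eq_le => /eqP <- [].
Qed.

Lemma running_max_step (a b : R) : 0 <= a -> a <= b ->
  M b = M a \/ exists2 s, a <= s <= b & M b = F s.
Proof.
move=> a0 ab; have [s /andP[s0 sb] [Mb _]] := running_max_arg b (le_trans a0 ab).
have [sa|/ltW sa] := leP s a; last by right; exists s; rewrite ?sa.
left; apply/le_anti; rewrite (running_max_homo a b)// andbT Mb.
by apply: le_running_max; rewrite s0.
Qed.

(** If the maximum grows over [a, b], its new value is F s for some s in [a, b], and F a <= M a
    gives M b - M a <= F s - F a. *)
Lemma running_max_sub_itv (a b : R) : 0 <= a -> a <= b ->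
  exists a' b', [/\ a <= a', a' <= b', b' <= b & `|M b - M a| <= `|F b' - F a'|].
Proof.
move=> a0 ab; have Mab := running_max_homo _ _ a0 ab.
have [->|[s /andP[as_ sb] Mb]] := running_max_step _ _ a0 ab.
  by exists a, a; rewrite lexx subrr normr0 normr_ge0.
exists a, s; split => //. rewrite ger0_norm ?subr_ge0// Mb.
apply: le_trans (ler_norm _); rewrite lerD2l lerN2.
by apply: le_running_max; rewrite a0 lexx.
Qed.

Lemma running_max_dist (t e : R) : 0 <= t -> 0 < e -> exists2 d, 0 < d &
  forall s, 0 <= s -> `|t - s| < d -> `|M t - M s| < e /\ `|F t - F s| < e.
Proof.
move=> t0 e0; have e20 : 0 < e / 2 by rewrite divr_gt0.
have t0' : `[0, +oo[%classic t by rewrite /= in_itv/= t0.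
have /subspace_continuousP/(_ _ t0')/cvgrPdist_lt/(_ _ e20)[d /= d0 dP] := cF.
have {}dP s : 0 <= s -> `|t - s| < d -> `|F t - F s| < e / 2.
  by move=> s0 ts; apply: dP => //=; rewrite in_itv/= s0.
exists d => // s s0 ts; split; last by have := dP _ s0 ts; lra.
have close a b : 0 <= a -> a <= b -> `|t - a| < d -> `|t - b| < d ->
    `|M b - M a| < e.
  move=> a0 ab ta tb.
  have [a' [b' [aa' a'b' b'b]]] := running_max_sub_itv _ _ a0 ab.
  move=> /le_lt_trans; apply.
  have fa : `|F t - F a'| < e / 2.
    by apply: dP; [lra|move: ta tb; rewrite !ltr_norml; lra].
  have fb : `|F t - F b'| < e / 2.
    by apply: dP; [lra|move: ta tb; rewrite !ltr_norml; lra].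
  by move: fa fb; rewrite !ltr_norml; lra.
by have [st|/ltW st] := leP s t; [|rewrite distrC]; apply: close => //;
  rewrite subrr normr0.
Qed.

Lemma running_max_in_E : F 0 = 0 -> in_E M.
Proof.
move=> F0; split.
- by move=> t t0; rewrite -F0 le_running_max// lexx.
- exact: running_max_homo.
- move=> t t0; apply/cvgrPdist_lt => e e0.
  have [d d0 dP] := running_max_dist t e t0 e0.
  exists d => //= s ts st; apply: (dP s _ ts).1.
  by rewrite (le_trans t0)// ltW.
- move=> t t0; apply/cvg_ex; exists (M t); apply/cvgrPdist_lt => e e0.
  have [d d0 dP] := running_max_dist t e (ltW t0) e0.
  exists (Num.min d t) => /=; first by rewrite lt_min d0.
  move=> s /=; rewrite lt_min => /andP[ts tst] st; apply: (dP s _ ts).1.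
  by move: tst; rewrite ltr_norml; lra.
Qed.

(** By continuity F stays below M near t, so M cannot grow there and is locally constant. *)
Lemma running_max_derive_below (t m : R) : 0 < t -> F t < M t ->
  is_derive t 1 M m -> m = 0.
Proof.
move=> t0 FM dM; apply: is_derive_unique dM _.
have dcst : is_derive t (1 : R) (cst (M t)) (0 : R) by exact: is_derive_cst.
apply: near_eq_is_derive dcst.
have e0 : 0 < (M t - F t) / 2 by rewrite divr_gt0// subr_gt0.
have [d d0 dP] := running_max_dist t _ (ltW t0) e0.
have fit s : 0 <= s -> `|t - s| < d -> M s = M t.
  move=> s0 ts.
  have below u a b : 0 <= u -> `|t - u| < d -> `|t - a| < d -> `|t - b| < d ->
     0 <= b -> M b != F u.
    move=> u0 tu ta tb b0; have [_ Fu] := dP u u0 tu; have [Mb _] := dP b b0 tb.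
    by apply/eqP => E; move: Fu Mb; rewrite E !ltr_norml; lra.
  have tt : `|t - t| < d by rewrite subrr normr0.
  have [st|/ltW st] := leP s t.
  - have [->//|[u /andP[su ut] /eqP E]] := running_max_step _ _ s0 st.
    exfalso; apply/negP: E; apply: (below u t t) => //; try lra.
    by move: ts; rewrite !ltr_norml; lra.
  - have [->//|[u /andP[su ut] /eqP E]] := running_max_step _ _ (ltW t0) st.
    exfalso; apply/negP: E; apply: (below u t s) => //; try lra.
    by move: ts; rewrite !ltr_norml; lra.
near=> s; rewrite /cst; apply/esym/fit.
  by apply/ltW; near: s; exact: lt_nbhsr.
by near: s; exists d.
Unshelve. all: by end_near. Qed.

End RunningMax.

                 

(** * The Hamilton-Jacobi equation and its smaller root *)

Section HamiltonJacobi.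
Context {R : realType}.
Variables (r c1 c2 y x : R) (h : R -> R).

(** Freezing h outside [0, x] makes it, and the functions built on it, continuous and monotone on
    all of R, and hides the values of h outside its domain. *)
Definition capped (u : R) : R := h (clamp 0 x u).

Definition speed (u : R) : R := Num.sqrt (y ^+ 2 - capped u / cpar c1 c2).

(** The smaller root l of l^2/(4c) + y l + capped u = 0; it is the derivative of the candidate
    value. *)
Definition marginal (u : R) : R := 2 * cpar c1 c2 * (- y - speed u).

Hypotheses (r_gt0 : 0 < r) (c1_gt0 : 0 < c1) (c2_gt0 : 0 < c2).

Local Notation c := (cpar c1 c2).

Lemma cpar_gt0 : 0 < c.
Proof. by rewrite /cpar invr_gt0 addr_gt0// invr_gt0. Qed.

Let c_neq0 : c != 0.
Proof. by rewrite gt_eqF// cpar_gt0. Qed.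

(** Young's inequality, by completing two squares. The losses l^2/(4 c1) and l^2/(4 c2) add up to
    l^2/(4c) because 1/c = 1/c1 + 1/c2. *)
Lemma action_density_ge (l p1 p2 : R) :
  l * (p1 - p2) - l ^+ 2 / (4 * c) <= c1 * p1 ^+ 2 + c2 * p2 ^+ 2.
Proof.
have -> : l ^+ 2 / (4 * c) = l ^+ 2 / (4 * c1) + l ^+ 2 / (4 * c2).
  by rewrite /cpar; field; rewrite !gt_eqF//= addr_gt0.
rewrite -subr_ge0.
have -> : c1 * p1 ^+ 2 + c2 * p2 ^+ 2 -
    (l * (p1 - p2) - (l ^+ 2 / (4 * c1) + l ^+ 2 / (4 * c2))) =
    c1 * (p1 - l / (2 * c1)) ^+ 2 + c2 * (p2 + l / (2 * c2)) ^+ 2.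
  by field; rewrite !gt_eqF.
by rewrite addr_ge0// mulr_ge0 ?sqr_ge0// ltW.
Qed.

Hypotheses (x_ge0 : 0 <= x) (h0 : h 0 = 0)
  (h_homo : forall u v, 0 <= u -> u <= v -> v <= x -> h u <= h v)
  (h_cont : {within `[0, x], continuous h})
  (y_le : r / (4 * c) <= - y)
  (hx_lt : h x + r * y + r ^+ 2 / (4 * c) < 0).

Lemma capped_homo : {homo capped : u v / u <= v}.
Proof.
move=> u v uv; have /andP[u0 _] := clamp_itv 0 x u x_ge0.
have /andP[_ vx] := clamp_itv 0 x v x_ge0.
by apply: h_homo => //; exact: clamp_homo.
Qed.

Lemma capped_le u : 0 <= capped u <= h x.
Proof.
have /andP[u0 ux] := clamp_itv 0 x u x_ge0.
by rewrite -h0 !h_homo.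
Qed.

Lemma cappedE u : 0 <= u <= x -> capped u = h u.
Proof. by move=> ux; rewrite /capped clampE. Qed.

Lemma capped_continuous : continuous capped.
Proof. exact: within_clamp_continuous. Qed.

Lemma y_lt0 : y < 0.
Proof.
have := cpar_gt0; have : 0 < r / (4 * c) by rewrite divr_gt0// mulr_gt0// cpar_gt0.
by move: y_le; lra.
Qed.

(** By [hx_lt] the quadratic in l of the Hamilton-Jacobi equation is negative at l = r, so r lies
    strictly between its roots. Positivity of the discriminant and the bound [marginal_le] both come
    from this. *)
Let discr_gt u : (y + r / (2 * c)) ^+ 2 < y ^+ 2 - capped u / c.
Proof.
have /andP[_ ux] := capped_le u.
rewrite -subr_gt0 -(pmulr_rgt0 _ cpar_gt0).
have -> : c * (y ^+ 2 - capped u / c - (y + r / (2 * c)) ^+ 2) =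
    - (capped u + r * y + r ^+ 2 / (4 * c)) by field.
by rewrite oppr_gt0; apply: le_lt_trans hx_lt; rewrite !lerD2r.
Qed.

Let discr_gt0 u : 0 < y ^+ 2 - capped u / c.
Proof. by apply: le_lt_trans (discr_gt u); rewrite sqr_ge0. Qed.

Lemma speed_gt0 u : 0 < speed u.
Proof. by rewrite sqrtr_gt0. Qed.

Lemma speed_sqr u : speed u ^+ 2 = y ^+ 2 - capped u / c.
Proof. by rewrite sqr_sqrtr// ltW. Qed.

Lemma speed_continuous : continuous speed.
Proof.
move=> u; apply: continuous_comp; last exact: sqrt_continuous.
apply: cvgB; first exact: cvg_cst.
by apply: cvgMl; exact: capped_continuous.
Qed.

Lemma speed_le u : speed u <= - y.
Proof.
have ny : 0 <= - y by rewrite oppr_ge0 ltW// y_lt0.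
rewrite -(ler_pXn2r (n := 2))// ?nnegrE ?sqrtr_ge0// speed_sqr sqrrN.
rewrite gerBl divr_ge0//; last by rewrite ltW// cpar_gt0.
by have /andP[] := capped_le u.
Qed.

Lemma marginal_ge0 u : 0 <= marginal u.
Proof.
rewrite /marginal mulr_ge0 ?subr_ge0 ?speed_le// mulr_ge0// ltW//.
exact: cpar_gt0.
Qed.

Lemma marginal_le u : marginal u <= r.
Proof.
have c2r : 2 * c * (r / (2 * c)) = r by field.
have : - y - r / (2 * c) <= speed u.
  rewrite -opprD; apply: le_trans (ler_norm _) _; rewrite normrN.
  by rewrite -sqrtr_sqr ler_wsqrtr// ltW.
move=> H; rewrite -[leRHS]c2r /marginal ler_pM2l ?mulr_gt0// ?cpar_gt0//.
lra.
Qed.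

Lemma marginal_homo : {homo marginal : u v / u <= v}.
Proof.
move=> u v uv; rewrite /marginal ler_pM2l ?mulr_gt0// ?cpar_gt0//.
rewrite lerD2l lerN2 ler_wsqrtr// lerD2l lerN2.
by rewrite ler_wpM2r ?capped_homo// ltW// invr_gt0 cpar_gt0.
Qed.

Lemma marginal_continuous : continuous marginal.
Proof.
move=> u; apply: cvgMr; apply: cvgB; first exact: cvg_cst.
exact: speed_continuous.
Qed.

Lemma hamilton_jacobi u :
  capped u + marginal u * y + marginal u ^+ 2 / (4 * c) = 0.
Proof.
have -> : capped u = c * (y ^+ 2 - speed u ^+ 2) by rewrite speed_sqr; field.
by rewrite /marginal; field.
Qed.

(** * The barrier strategy *)

Notation mu := (@lebesgue_measure R).
Local Notation path2 := ((R -> R) * (R -> R))%type.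
Local Notation M := running_max.
Implicit Types psi : path2.

Definition drift psi (t : R) : R := y * t + psi.1 t - psi.2 t.

(** Skorokhod reflection at x: the least nondecreasing push that keeps the state at or below x. *)
Definition barrier psi : R -> R := M (drift psi).

Lemma drift_continuous psi : in_P2 psi ->
  {within `[0, +oo[, continuous (drift psi)}.
Proof.
move=> [[p1 _] [p2 _]].
have cy : {within `[0, +oo[, continuous (fun t : R => y * t)}.
  by apply: continuous_subspaceT => s; apply: cvgMr; exact: cvg_id.
by move=> t; apply: cvgB; [apply: cvgD; [exact: cy|exact: p1]|exact: p2].
Qed.

Lemma drift0 psi : in_P2 psi -> drift psi 0 = 0.
Proof. by move=> [[_ p1] [_ p2]]; rewrite /drift p1 p2 mulr0 !addr0 subrr. Qed.

Lemma phi_barrierE psi t : phi y x psi (barrier psi) t = x + drift psi t - barrier psi t.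
Proof. by rewrite /phi /drift !addrA. Qed.

Lemma phi_barrier_le psi t : in_P2 psi -> 0 <= t ->
  phi y x psi (barrier psi) t <= x.
Proof.
move=> pP t0; rewrite phi_barrierE.
have := le_running_max _ (drift_continuous _ pP) t t; rewrite t0 lexx => /(_ isT).
by rewrite -/(barrier psi); lra.
Qed.

Lemma barrier_strategy : strategy barrier.
Proof.
split=> [psi pP|psi psi' pP pP' t t0 E s /andP[s0 st]].
  exact: running_max_in_E (drift_continuous _ pP) (drift0 _ pP).
rewrite /barrier /running_max; congr sup; apply/seteqP.
have EF u : 0 <= u <= s -> drift psi u = drift psi' u.
  move=> /andP[u0 us]; rewrite /drift.
  by have [|-> ->] := E u; rewrite ?u0 ?(le_trans us).
by split=> z [u /=]; rewrite in_itv/= => us <-; exists u => //=; rewrite ?in_itv//= EF.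
Qed.

Lemma phi_barrier_continuous psi : in_P2 psi ->
  {within `[0, +oo[, continuous (phi y x psi (barrier psi))}.
Proof.
move=> pP; apply/subspace_continuousP => t /=; rewrite in_itv/= andbT => t0.
apply/cvgrPdist_lt => e e0; have e20 : 0 < e / 2 by rewrite divr_gt0.
have [d d0 dP] := running_max_dist _ (drift_continuous _ pP) t _ t0 e20.
exists d => // s /= ts; rewrite in_itv/= andbT => s0.
rewrite /from_subspace !phi_barrierE; have := dP s s0 ts; rewrite -/(barrier psi) !ltr_norml.
lra.
Qed.

(** The state is continuous and starts at x, so a negative value would be preceded by a zero,
    although t does not exceed the hitting time. *)
Lemma phi_barrier_itv psi t : in_P2 psi -> 0 <= t ->
  (t%:E <= tau y x psi (barrier psi))%E ->
  0 <= phi y x psi (barrier psi) t <= x.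
Proof.
move=> pP t0 ttau; rewrite phi_barrier_le// andbT leNgt; apply/negP => phit.
have phi0 : phi y x psi (barrier psi) 0 = x.
  rewrite phi_barrierE drift0// /barrier running_max0; last exact: drift_continuous.
  by rewrite drift0// addr0 subr0.
have cphi : {within `[0, t], continuous (phi y x psi (barrier psi))}.
  apply: continuous_subspaceW (phi_barrier_continuous _ pP) => s /=.
  by rewrite !in_itv/= andbT => /andP[].
have [|s] := IVT t0 cphi (v := 0).
  by rewrite phi0 ge_min le_max x_ge0 (ltW phit) orbT.
rewrite in_itv/= => /andP[s0 st] phis.
have ss : (tau y x psi (barrier psi) <= s%:E)%E.
  by apply: ereal_inf_lbound; exists s.
have := le_trans ttau ss; rewrite lee_fin => ts.
by move: phit; rewrite (_ : t = s) ?phis ?ltxx//; apply/le_anti; rewrite ts st.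
Qed.

Lemma barrier_admissible (D : R) : x <= D -> admissible D y x barrier.
Proof.
move=> xD; split; first exact: barrier_strategy.
move=> psi pP t t0 ttau; have /andP[-> /=] := phi_barrier_itv _ _ pP t0 ttau.
by move/le_trans; apply.
Qed.

(** * Upper bound: the barrier strategy costs at most V(x) *)

Section Primitive.
Variable V : R -> R.
Hypotheses (V0 : V 0 = 0)
  (V' : forall u : R, -1 < u -> is_derive u 1 V (marginal u)).

Let V_cont u : -1 < u -> {for u, continuous V}.
Proof. by move=> /V' [dV _]; apply/differentiable_continuous/derivable1_diffP. Qed.

Lemma value_within_continuous a b : 0 <= a -> {within `[a, b], continuous V}.
Proof.
move=> a0; apply: continuous_in_subspaceT => u /set_mem/=.
by rewrite in_itv/= => /andP[au _]; apply: V_cont; lra.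
Qed.

Lemma value_homo u w : 0 <= u -> u <= w -> V u <= V w.
Proof.
move=> u0 uw; apply: (is_derive_ge0_le _ marginal) => //.
- exact: value_within_continuous.
- by move=> t /andP[ut _]; apply: V'; lra.
- by move=> t _; exact: marginal_ge0.
Qed.

Lemma value_ge0 u : 0 <= u -> 0 <= V u.
Proof. by rewrite -{2}V0; exact: value_homo. Qed.

(** The function l t - V t is nondecreasing on [u, w]. It serves with l = r for the Lipschitz bound,
    and with l = [marginal p] for the tangent inequality of the convex function V at p. *)
Lemma value_increment_le l u w : 0 <= u -> u <= w ->
  (forall t, u < t < w -> marginal t <= l) -> V w - V u <= l * (w - u).
Proof.
move=> u0 uw lP.
have : l * u - V u <= l * w - V w.
  apply: (is_derive_ge0_le (fun t => l * t - V t) (fun t => l - marginal t)) => //.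
  - apply: continuous_in_subspaceT => t /set_mem/=.
    rewrite in_itv/= => /andP[ut _]; apply: cvgB; last by apply: V_cont; lra.
    by apply: cvgMr; exact: cvg_id.
  - move=> t /andP[ut tw]; have dV : is_derive t 1 V (marginal t) by apply: V'; lra.
    have dl : is_derive t 1 (l \*: (@id R)) (l *: 1) by exact: is_deriveZ.
    by rewrite -[X in X - _]mulr1; exact: (is_deriveB dl dV).
  - by move=> t tuw; rewrite subr_ge0 lP.
by lra.
Qed.

Lemma value_lipschitz u w : 0 <= u -> 0 <= w -> `|V w - V u| <= r * `|w - u|.
Proof.
wlog uw : u w / u <= w.
  move=> H u0 w0; have [uw|/ltW wu] := leP u w; first exact: H.
  by rewrite distrC [X in _ <= _ * X]distrC; exact: H.
move=> u0 _; rewrite !ger0_norm ?subr_ge0 ?value_homo//.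
by apply: value_increment_le => // t _; exact: marginal_le.
Qed.

(** The verification inequality at a point of differentiability. Below x the control has rate 0, and
    the Hamilton-Jacobi equation meets [action_density_ge] with l = [marginal]; at x the same
    estimate with l = r is closed by [hx_lt]. *)
Lemma barrier_running_cost_rate psi (t k p1 p2 m : R) : in_P2 psi -> 0 < t ->
  is_derive t 1 psi.1 p1 -> is_derive t 1 psi.2 p2 ->
  is_derive t 1 (barrier psi) m -> 0 <= phi y x psi (barrier psi) t <= x ->
  is_derive t 1 (fun s => V (phi y x psi (barrier psi) s) + r * barrier psi s) k ->
  k + capped (phi y x psi (barrier psi) t) <= c1 * p1 ^+ 2 + c2 * p2 ^+ 2.
Proof.
move=> pP t0 dp1 dp2 dm /andP[ph0 phx] dk.
have ddrift : is_derive t 1 (drift psi) (y + p1 - p2).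
  have dy : is_derive t 1 (y \*: (@id R)) (y *: 1) by exact: is_deriveZ.
  by rewrite -[y in y + p1]mulr1; exact: (is_deriveB (is_deriveD dy dp1) dp2).
have dphi : is_derive t 1 (phi y x psi (barrier psi)) (y + p1 - p2 - m).
  have dx : is_derive t (1 : R) (cst x) (0 : R) by exact: is_derive_cst.
  rewrite -[y + p1 - p2]add0r.
  rewrite (_ : phi y x psi (barrier psi) = cst x + drift psi - barrier psi).
    exact: (is_deriveB (is_deriveD dx ddrift) dm).
  by apply/funext => s; rewrite phi_barrierE.
have dVphi : is_derive t 1 (V \o phi y x psi (barrier psi))
    (marginal (phi y x psi (barrier psi) t) * (y + p1 - p2 - m)).
  have dVphi : is_derive (phi y x psi (barrier psi) t) 1 V
      (marginal (phi y x psi (barrier psi) t)) by apply: V'; lra.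
  exact: (is_derive1_comp dVphi dphi).
have dK : is_derive t 1 (fun s => V (phi y x psi (barrier psi) s) + r * barrier psi s)
    (marginal (phi y x psi (barrier psi) t) * (y + p1 - p2 - m) + r * m).
  have drm : is_derive t 1 (r \*: barrier psi) (r *: m) by exact: is_deriveZ.
  exact: (is_deriveD dVphi drm).
rewrite (is_derive_unique _ _ _ _ dk dK).
have cF := drift_continuous _ pP.
have : drift psi t <= barrier psi t.
  by apply: le_running_max => //; rewrite lexx ltW.
rewrite le_eqVlt => /predU1P[FM|FM].
- have phixE : phi y x psi (barrier psi) t = x by rewrite phi_barrierE FM addrK.
  (* [barrier - drift] is nonnegative and vanishes at t, so its derivative there is 0: the control
     cancels the drift. *)
  have : m - (y + p1 - p2) = 0.
    apply: (is_derive_local_min0 (barrier psi - drift psi) t).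
    + by rewrite !fctE FM subrr.
    + near=> s; rewrite !fctE subr_ge0; apply: le_running_max => //.
      rewrite lexx andbT; apply/ltW; near: s; exact: lt_nbhsr.
  move=> /eqP; rewrite subr_eq0 => /eqP ->; rewrite subrr mulr0 add0r phixE.
  rewrite cappedE ?lexx ?x_ge0//.
  apply: le_trans (action_density_ge r p1 p2).
  by move: hx_lt; rewrite -mulrA => H; lra.
- have m0 : m = 0 by apply: (running_max_derive_below (drift psi) cF t m).
  rewrite m0 mulr0 subr0 addr0.
  set l := marginal _; apply: le_trans (action_density_ge l p1 p2).
  by have := hamilton_jacobi (phi y x psi (barrier psi) t); rewrite -/l; lra.
Unshelve. all: by end_near. Qed.

Lemma absolutely_continuous_barrier_value psi T : in_P2 psi -> 0 <= T ->
  absolutely_continuous T psi.1 -> absolutely_continuous T psi.2 ->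
  (forall t, 0 <= t <= T -> 0 <= phi y x psi (barrier psi) t) ->
  absolutely_continuous T (barrier psi) /\
  absolutely_continuous T
    (fun s => V (phi y x psi (barrier psi) s) + r * barrier psi s).
Proof.
move=> pP T0 ac1 ac2 ph0.
have scale f (l : R) : absolutely_continuous T f ->
    absolutely_continuous T (fun t => l * f t).
  apply: (absolutely_continuous_lipschitz _ `|l|) => s t _ _.
  by rewrite -mulrBr normrM.
have acF : absolutely_continuous T (drift psi).
  apply: absolutely_continuousD; last exact: absolutely_continuousN.
  by apply: absolutely_continuousD => //; apply: scale; exact: absolutely_continuous_id.
have acM : absolutely_continuous T (barrier psi).
  apply: absolutely_continuous_sub_itv acF => a b a0 ab _.
  exact: running_max_sub_itv (drift_continuous _ pP) _ _ a0 ab.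
have acphi : absolutely_continuous T (phi y x psi (barrier psi)).
  apply: (@absolutely_continuous_lipschitz _ (drift psi \+ \- barrier psi) _ 1).
    move=> s t _ _; rewrite !phi_barrierE mul1r /= le_eqVlt; apply/orP; left.
    by apply/eqP; congr (`| _ |); ring.
  by apply: absolutely_continuousD => //; exact: absolutely_continuousN.
split=> //; apply: absolutely_continuousD; last exact: scale.
apply: absolutely_continuous_lipschitz acphi => s t sT tT.
exact: value_lipschitz (ph0 _ sT) (ph0 _ tT).
Qed.

Lemma tau_ge0 psi rho : (0 <= tau y x psi rho)%E.
Proof. by apply: le_ereal_inf_tmp => _ [t [t0 _] <-]; rewrite lee_fin. Qed.

(** Integrate [barrier_running_cost_rate] over [0, T] and drop the final term V(phi(T)) >= 0. *)
Lemma action_barrier_ge psi T : in_P2 psi -> 0 < T ->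
  absolutely_continuous T psi.1 -> absolutely_continuous T psi.2 ->
  (forall t, 0 <= t <= T -> 0 <= phi y x psi (barrier psi) t <= x) ->
  (\int[mu]_(t in `[0%R, T]) (h (phi y x psi (barrier psi) t))%:E +
     (r * barrier psi T)%:E - (V x)%:E <= action c1 c2 T psi)%E.
Proof.
move=> pP T0 ac1 ac2 phP.
have [acM acK] := absolutely_continuous_barrier_value _ _ pP (ltW T0) ac1 ac2
  (fun t tT => (andP (phP t tT)).1).
pose K s := V (phi y x psi (barrier psi) s) + r * barrier psi s.
have [k [ik kE dk]] := absolutely_continuous_density T0 acK.
have [p1 [_ _ d1]] := absolutely_continuous_density T0 ac1.
have [p2 [_ _ d2]] := absolutely_continuous_density T0 ac2.
have [m [_ _ dM]] := absolutely_continuous_density T0 acM.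
(* Clamping the time makes the running cost continuous on all of R, hence integrable on [0, T]. *)
pose H t := capped (phi y x psi (barrier psi) (clamp 0 T t)).
have cphi : continuous (phi y x psi (barrier psi) \o clamp 0 T).
  apply: within_clamp_continuous; first exact: ltW.
  apply: continuous_subspaceW (phi_barrier_continuous _ pP) => s /=.
  by rewrite !in_itv/= andbT => /andP[].
have cH : continuous H.
  by move=> t; apply: continuous_comp; [exact: cphi|exact: capped_continuous].
have iH : mu.-integrable `[0, T] (EFin \o H).
  apply: continuous_compact_integrable; first exact: segment_compact.
  exact: continuous_subspaceT.
have ikT : mu.-integrable `[0, T] (EFin \o k) by exact: integrableS ik.
have -> : (\int[mu]_(t in `[0%R, T]) (h (phi y x psi (barrier psi) t))%:E =
           \int[mu]_(t in `[0%R, T]) (H t)%:E)%E.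
  apply: eq_integral => t; rewrite inE/= in_itv/= => tT.
  by rewrite /H clampE// cappedE// phP.
have K0 : K 0 = V x.
  rewrite /K phi_barrierE drift0// /barrier running_max0; last exact: drift_continuous.
  by rewrite drift0// mulr0 !addr0 subr0.
have kT : (\int[mu]_(t in `[0%R, T]) (k t)%:E = (K T - V x)%:E)%E.
  by rewrite kE -?K0// lexx ltW.
have -> : action c1 c2 T psi = (\int[mu]_(s in `[0%R, T])
    (c1 * (derive1 psi.1 s) ^+ 2 + c2 * (derive1 psi.2 s) ^+ 2)%:E)%E.
  by rewrite /action asboolT.
apply: (@le_trans _ _ (\int[mu]_(t in `[0%R, T]) ((k t + H t)%:E))%E).
  rewrite integralD_EFin// kT [leRHS]addeC -addeA; apply: leeD => //.
  rewrite -EFinB lee_fin lerD2r /K lerDr value_ge0//.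
  have TT : 0 <= T <= T by rewrite lexx ltW.
  by have /andP[] := phP _ TT.
apply: le_integral_nonneg_ae => //=.
- rewrite (_ : EFin \o _ = (EFin \o k) \+ (EFin \o H))%E//; exact: integrableD.
- by move=> t _; rewrite addr_ge0// mulr_ge0 ?sqr_ge0// ltW.
(* The rate inequality is available outside the null set where one of the four derivatives fails;
   the end points 0 and T are discarded as well. *)
have ae := ae_filter_ringOfSetsType mu.
have /(@filterS _ _ ae) := @filterI _ _ ae _ _ (@filterI _ _ ae _ _ dk dM)
  (@filterI _ _ ae _ _ (@filterI _ _ ae _ _ d1 d2)
    (@filterI _ _ ae _ _ (ae_neq 0) (ae_neq T))).
apply=> t [[dkt dMt] [[d1t d2t] [/eqP t0 /eqP tT]]]; rewrite /= in_itv/= => t0T.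
have {}t0T' : 0 < t < T by case/andP: t0T => ? ?; rewrite !lt_neqAle eq_sym t0 tT; apply/andP.
have dd1 := d1t t0T'; have dd2 := d2t t0T'.
have -> : derive1 psi.1 t = p1 t by rewrite derive1E derive_val.
have -> : derive1 psi.2 t = p2 t by rewrite derive1E derive_val.
rewrite /H clampE//; have /andP[t0' _] := t0T'.
exact: (barrier_running_cost_rate _ _ _ _ _ _ pP t0' dd1 dd2 (dMt t0T') (phP _ t0T) (dkt t0T')).
Qed.

Lemma cost_barrier_le psi : in_P2 psi -> (tau y x psi (barrier psi) < +oo)%E ->
  (cost r c1 c2 y h x psi (barrier psi) <= (V x)%:E)%E.
Proof.
move=> pP tauoo; rewrite /cost.
have tau0 := tau_ge0 psi (barrier psi).
have tauE : tau y x psi (barrier psi) = (fine (tau y x psi (barrier psi)))%:E.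
  by rewrite fineK// ge0_fin_numE.
set T := fine _ in tauE *.
have T0 : 0 <= T by rewrite -lee_fin -tauE.
have phP t : 0 <= t <= T -> 0 <= phi y x psi (barrier psi) t <= x.
  by move=> /andP[t0 tT]; apply: phi_barrier_itv; rewrite // tauE lee_fin.
have [[ac1 ac2]|nac] := pselect
    (absolutely_continuous T psi.1 /\ absolutely_continuous T psi.2); last first.
  (* Infinite action makes the cost minus infinity. *)
  by rewrite /action asboolF// addeNy leNye.
have action_ge0 : (0 <= action c1 c2 T psi)%E.
  rewrite /action asboolT//; apply: integral_ge0 => t _.
  by rewrite lee_fin addr_ge0// mulr_ge0 ?sqr_ge0// ltW.
(* A game that ends at time 0 has no running cost, and the barrier starts without a jump. *)
move: T0; rewrite le_eqVlt => /predU1P[T0|T0].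
  rewrite -T0 set_itv1 integral_set1 add0e.
  rewrite /barrier running_max0; last exact: drift_continuous.
  rewrite drift0// mulr0 sub0e; apply: (@le_trans _ _ 0%E).
    by rewrite leeNl oppe0 T0.
  by rewrite lee_fin value_ge0.
have := action_barrier_ge _ _ pP T0 ac1 ac2 phP.
set I := (\int[mu]_(_ in _) _)%E; set B := (_ * _); set A := action _ _ _ _.
have : (0 <= I)%E.
  apply: integral_ge0 => t; rewrite /= in_itv/= => tT.
  have phit := phP _ tT.
  by rewrite lee_fin -cappedE//; have /andP[] := capped_le (phi y x psi (barrier psi) t).
case: I => [I| |] // _.
- case: A action_ge0 => [A| |]//= _; rewrite -?EFinD -?EFinN -?EFinD ?lee_fin; first by lra.
  by rewrite leNye.
- by case: A action_ge0 => [A| |]//= _ _; exact: leNye.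
Qed.

Lemma value_ge_U (D : R) : x <= D -> (U D r c1 c2 y h x <= (V x)%:E)%E.
Proof.
move=> xD.
apply: (@le_trans _ _ (ereal_sup [set cost r c1 c2 y h x psi (barrier psi) |
    psi in Q y x barrier])).
  by apply: ereal_inf_lbound; exists barrier => //; exact: barrier_admissible.
by apply: ge_ereal_sup => _ [psi [pP tauoo] <-]; exact: cost_barrier_le.
Qed.

(** * The uncontrolled path *)

Section UncontrolledPath.
Variable omega : R -> R.
Local Notation S := (tau_tilde c1 c2 y h x).
Hypotheses (omega0 : omega 0 = 0)
  (omega' : has_derivative_on `[0, S] omega (fun t =>
     - y - Num.sqrt (y ^+ 2 - h (Num.min (x + y * t + omega t) x) / c))).

Definition free_path (t : R) : R := x + y * t + omega t.
Local Notation X := free_path.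

Lemma free_path0 : X 0 = x.
Proof. by rewrite /free_path omega0 mulr0 !addr0. Qed.

Lemma free_path_within_continuous : {within `[0, S], continuous X}.
Proof.
have co := has_derivative_on_within_continuous _ _ _ _ omega'.
move=> t; apply: cvgD; last exact: co.
have cy : {within `[0, S], continuous (fun t : R => x + y * t)}.
  apply: continuous_subspaceT => s; apply: cvgD; first exact: cvg_cst.
  by apply: cvgMr; exact: cvg_id.
exact: cy.
Qed.

Let cX a b : 0 <= a -> b <= S -> {within `[a, b], continuous X}.
Proof.
move=> a0 bS; apply: continuous_subspaceW free_path_within_continuous => t /=.
by rewrite !in_itv/= => /andP[/(le_trans a0)-> /le_trans->].
Qed.

Let dX_sqrt t : 0 < t < S ->
  is_derive t 1 X (- Num.sqrt (y ^+ 2 - h (Num.min (X t) x) / c)).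
Proof.
move=> tS; have dom := has_derivative_on_is_derive _ _ _ _ _ omega' tS.
have dx : is_derive t (1 : R) (cst x) (0 : R) by exact: is_derive_cst.
have dy : is_derive t 1 (y \*: (@id R)) (y *: 1) by exact: is_deriveZ.
have dX : is_derive t 1 X _ := is_deriveD (is_deriveD dx dy) dom.
by apply: is_derive_eq dX _; rewrite /free_path add0r [_ *: 1]mulr1; ring.
Qed.

Lemma free_path_decreasing s t : 0 <= s -> s <= t -> t <= S -> X t <= X s.
Proof.
move=> s0 st tS; rewrite -lerN2.
apply: (is_derive_ge0_le (- X)
  (fun t => Num.sqrt (y ^+ 2 - h (Num.min (X t) x) / c))) => [//|u|u|u _].
- by apply: cvgN; exact: (cX _ _ s0 tS).
- move=> /andP[su ut]; rewrite -[Num.sqrt _]opprK; apply: is_deriveN.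
  by apply: dX_sqrt; apply/andP; split; lra.
- exact: sqrtr_ge0.
Qed.

Lemma free_path_le t : 0 <= t <= S -> X t <= x.
Proof. by move=> /andP[t0 tS]; rewrite -[leRHS]free_path0 free_path_decreasing. Qed.

Lemma free_path_is_derive t : 0 < t < S -> 0 <= X t ->
  is_derive t 1 X (- speed (X t)).
Proof.
move=> tS X0; have := dX_sqrt _ tS.
have Xx : X t <= x by apply: free_path_le; case/andP: tS => *; rewrite !ltW.
by rewrite min_l// /speed cappedE// X0.
Qed.

Lemma tau_tilde_ge0 : 0 <= S.
Proof. by apply: Rintegral_ge0 => t _; rewrite invr_ge0 sqrtr_ge0. Qed.

(** * The clock: time left until the uncontrolled path reaches 0 *)

Section Clock.
Variable clock : R -> R.
Hypotheses (clock0 : clock 0 = 0)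
  (clock' : forall u : R, -1 < u -> is_derive u 1 clock (speed u)^-1).

Let clock_cont u : -1 < u -> {for u, continuous clock}.
Proof. by move=> /clock' [d _]; apply/differentiable_continuous/derivable1_diffP. Qed.

Let clock_within a b : 0 <= a -> {within `[a, b], continuous clock}.
Proof.
move=> a0; apply: continuous_in_subspaceT => u /set_mem/=.
by rewrite in_itv/= => /andP[au _]; apply: clock_cont; lra.
Qed.

Lemma clock_lt u w : 0 <= u -> u < w -> clock u < clock w.
Proof.
move=> u0 uw; apply: (is_derive_gt0_lt _ (fun u => (speed u)^-1)) => //.
- exact: clock_within.
- by move=> t /andP[ut _]; apply: clock'; lra.
- by move=> t _; rewrite invr_gt0 speed_gt0.
Qed.

Lemma clock_tau_tilde : clock x = S.
Proof.
rewrite /tau_tilde /Rintegral.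
have -> : (\int[mu]_(u in `[0%R, x]) ((Num.sqrt (y ^+ 2 - h u / c))^-1)%:E =
           \int[mu]_(u in `[0%R, x]) ((speed u)^-1)%:E)%E.
  apply: eq_integral => u; rewrite inE/= in_itv/= => ux.
  by rewrite /speed cappedE.
suff -> : (\int[mu]_(u in `[0%R, x]) ((speed u)^-1)%:E = (clock x - clock 0)%:E)%E.
  by rewrite clock0 subr0.
apply: continuous_FTC2_is_derive => //.
- apply: continuous_subspaceT => u; apply: cvgV; last exact: speed_continuous.
  by rewrite gt_eqF// speed_gt0.
- exact: clock_within.
- by move=> t /andP[t0 _]; apply: clock'; lra.
Qed.

(** Since X decreases, X t >= 0 gives nonnegativity on [0, t], where the equation reads X' =
    -speed(X). Hence clock(X) has derivative -1, and it starts from clock(x) = S. *)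
Lemma clock_free_path t : 0 <= t <= S -> 0 <= X t -> clock (X t) = S - t.
Proof.
move=> /andP[t0 tS] Xt0.
have Xs0 s : s <= t -> 0 <= s -> 0 <= X s.
  by move=> st s0; apply: le_trans Xt0 _; exact: free_path_decreasing.
have cc : {within `[0, t], continuous (clock \o X)}.
  apply: within_continuous_comp; last exact: (cX 0 t (lexx _) tS).
  move=> _ /set_mem [s /= + <-]; rewrite in_itv/= => /andP[s0 st].
  by apply: clock_cont; have := Xs0 _ st s0; lra.
have dc s : 0 < s < t -> is_derive s 1 (clock \o X) (-1).
  move=> /andP[s0 st]; have X0 : 0 <= X s by apply: Xs0; exact: ltW.
  have ds : is_derive s 1 X (- speed (X s)).
    by apply: free_path_is_derive => //; rewrite s0/=; exact: lt_le_trans tS.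
  have dcl : is_derive (X s) 1 clock (speed (X s))^-1 by apply: clock'; lra.
  have <- : (speed (X s))^-1 * - speed (X s) = -1.
    by rewrite mulrN mulVf// gt_eqF// speed_gt0.
  exact: is_derive1_comp.
have slope := is_derive_cst_slope _ _ _ _ t0 cc dc.
have -> : S = clock (X 0) by rewrite free_path0 clock_tau_tilde.
by move: slope => /=; lra.
Qed.

(** At a zero s of X the clock gives 0 = S - s. A negative value at t <= S would need a zero s <= t,
    forcing s = t = S. *)
Let X_ge0 t : 0 <= t <= S -> 0 <= X t.
Proof.
move=> /andP[t0 tS]; rewrite leNgt; apply/negP => Xt.
have [|s] := IVT t0 (cX 0 t (lexx _) tS) (v := 0).
  by rewrite free_path0 ge_min le_max x_ge0 (ltW Xt) orbT.
rewrite in_itv/= => /andP[s0 st] Xs.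
have := clock_free_path s; rewrite Xs lexx clock0 s0 (le_trans st tS).
by move=> /(_ isT isT) sS; move: Xt; rewrite (_ : t = s) ?Xs ?ltxx//; lra.
Qed.

Lemma free_path_end_clock : X S = 0.
Proof.
have SS : 0 <= S <= S by rewrite tau_tilde_ge0 lexx.
have XS := X_ge0 _ SS; apply/eqP; rewrite eq_le XS andbT leNgt; apply/negP => X0.
have := clock_lt 0 _ (lexx _) X0.
by rewrite clock0 clock_free_path// subrr ltxx.
Qed.

Lemma free_path_itv_clock t : 0 < t < S -> 0 < X t < x.
Proof.
move=> /andP[t0 tS]; have tS' : 0 <= t <= S by rewrite !ltW.
have := clock_free_path t tS' (X_ge0 _ tS'); have := X_ge0 _ tS'.
have := free_path_le t tS'; rewrite !le_eqVlt => /predU1P[->|->].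
  by rewrite clock_tau_tilde; lra.
by move=> /predU1P[<-|->//]; rewrite clock0; lra.
Qed.
End Clock.

Let clock_exists : exists2 clock : R -> R, clock 0 = 0 &
  forall u : R, -1 < u -> is_derive u 1 clock (speed u)^-1.
Proof.
apply: continuous_primitive => u; apply: cvgV; last exact: speed_continuous.
by rewrite gt_eqF// speed_gt0.
Qed.

Lemma free_path_end : X S = 0.
Proof. by have [clock k0 k'] := clock_exists; exact: (free_path_end_clock clock). Qed.

Lemma free_path_itv t : 0 < t < S -> 0 < X t < x.
Proof. by have [clock k0 k'] := clock_exists; exact: (free_path_itv_clock clock). Qed.

(** * Lower bound: every control against psi costs at least V(x) *)

Section Controlled.
Variables (D : R) (h1 : R -> R) (psi : path2) (rho : R -> R).
Hypotheses (x_lt_D : x < D) (h' : has_derivative_on `[0, D] h h1)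
  (h1_cont : {within `[0, D], continuous h1})
  (h_convex : convex_function (E := R^o) `[0, D]%classic h)
  (psiP : in_P2 psi)
  (psiE : forall t, 0 <= t <= S ->
     psi.1 t = c / c1 * omega t /\ psi.2 t = - (c / c2 * omega t))
  (rhoP : in_E rho) (rho_adm : stays_in D y x psi rho).

(** Since c/c1 + c/c2 = 1, the two components of psi combine to psi.1 - psi.2 = omega. *)
Lemma phi_free_path t : 0 <= t <= S -> phi y x psi rho t = X t - rho t.
Proof.
move=> /psiE[p1E p2E]; rewrite /phi p1E p2E /free_path opprK; congr (_ - _).
rewrite -addrA; congr (_ + _); rewrite -mulrDl -[RHS]mul1r; congr (_ * _).
by rewrite /cpar; field; rewrite !gt_eqF//= addr_gt0.
Qed.

Lemma phi_right_continuous t : 0 <= t -> phi y x psi rho s @[s --> t^'+] --> phi y x psi rho t.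
Proof.
move=> t0; have [_ _ rc _] := rhoP.
have t0' : `[0, +oo[%classic t by rewrite /= in_itv/= t0.
have cd := drift_continuous _ psiP.
have /subspace_continuousP/(_ _ t0')/cvgrPdist_lt cF := cd.
have phiE s : phi y x psi rho s = x + drift psi s - rho s by rewrite /phi /drift !addrA.
apply/cvgrPdist_lt => e e0; have e20 : 0 < e / 2 by rewrite divr_gt0.
have [d /= d0 dP] := cF _ e20.
have /cvgrPdist_lt/(_ _ e20)[k /= k0 kP] := rc t t0.
exists (Num.min d k) => /=; first by rewrite lt_min d0.
move=> s /=; rewrite lt_min => /andP[sd sk] ts.
have s0 : `[0, +oo[%classic s by rewrite /= in_itv/= andbT (le_trans t0)// ltW.
have := dP s sd s0; have := kP s sk ts; rewrite !phiE /from_subspace !ltr_norml.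
lra.
Qed.

(** At time S the state is -rho(S) <= 0, while admissibility keeps it nonnegative up to the hitting
    time, so the game ends by S. Right-continuity of rho makes the infimum in [tau] attained, whence
    rho T = X T. *)
Lemma hitting_time_free_path : exists T,
  [/\ tau y x psi rho = T%:E, 0 <= T, T <= S & rho T = X T].
Proof.
have S0 := tau_tilde_ge0.
have SS : 0 <= S <= S by rewrite S0 lexx.
have tauS : (tau y x psi rho <= S%:E)%E.
  rewrite leNgt; apply/negP => Stau.
  have /andP[phS _] := rho_adm S S0 (ltW Stau).
  have phS0 : phi y x psi rho S = 0.
    have [rho_ge0 _ _ _] := rhoP.
    move: phS; rewrite phi_free_path// free_path_end.
    by have := rho_ge0 S S0; lra.
  have : (tau y x psi rho <= S%:E)%E by apply: ereal_inf_lbound; exists S.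
  by rewrite leNgt Stau.
have tauE : tau y x psi rho = (fine (tau y x psi rho))%:E.
  by rewrite fineK// ge0_fin_numE ?tau_ge0// (le_lt_trans tauS)// ltry.
set T := fine _ in tauE.
have T0 : 0 <= T by rewrite -lee_fin -tauE tau_ge0.
have TS : T <= S by rewrite -lee_fin -tauE.
exists T; split => //.
suff : phi y x psi rho T = 0 by rewrite phi_free_path ?T0//; lra.
have /andP[phT _] : 0 <= phi y x psi rho T <= D by apply: rho_adm => //; rewrite tauE.
apply/eqP; rewrite eq_le phT andbT leNgt; apply/negP => ph_gt0.
have /cvgrPdist_lt/(_ _ ph_gt0)[d /= d0 dP] := phi_right_continuous T T0.
have : (tau y x psi rho < (T + d)%:E)%E by rewrite tauE lte_fin ltrDl.
move=> /ereal_inf_lt [_ [s [s0 phs] <-]]; rewrite lte_fin => sTd.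
have Ts : T <= s by rewrite -lee_fin -tauE; apply: ereal_inf_lbound; exists s.
move: Ts; rewrite le_eqVlt => /predU1P[Ts|Ts].
  by move: ph_gt0; rewrite Ts phs ltxx.
have Tsd : `|T - s| < d by rewrite ltr_norml; lra.
by have := dP s Tsd Ts; rewrite phs subr0 gtr0_norm// ltxx.
Qed.

Lemma free_path_rate t : 0 < t < S -> is_derive t 1 omega (- y - speed (X t)).
Proof.
move=> tS; have dom := has_derivative_on_is_derive _ _ _ _ _ omega' tS.
have /andP[X0 Xx] := free_path_itv _ tS.
apply: is_derive_eq dom _; rewrite -/(X t) min_l ?ltW// /speed cappedE// !ltW//.
Qed.

(** omega increases because speed <= -y, and at rate at most -y because X decreases. This makes psi
    absolutely continuous. *)
Lemma omega_lipschitz s t : 0 <= s <= S -> 0 <= t <= S ->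
  `|omega t - omega s| <= - y * `|t - s|.
Proof.
wlog st : s t / s <= t.
  move=> H sS tS; have [st|/ltW ts] := leP s t; first exact: H.
  by rewrite distrC [X in _ <= _ * X]distrC; exact: H.
move=> /andP[s0 _] /andP[_ tS]; rewrite [X in _ <= _ * X]ger0_norm ?subr_ge0//.
have := free_path_decreasing _ _ s0 st tS; rewrite /free_path => XX.
have : omega s <= omega t.
  apply: (is_derive_ge0_le _ (fun t => - y - speed (X t))) => //.
  - apply: continuous_subspaceW (has_derivative_on_within_continuous _ _ _ _ omega') => u /=.
    by rewrite !in_itv/= => /andP[/(le_trans s0)-> /le_trans->].
  - by move=> u /andP[su ut]; apply: free_path_rate; apply/andP; split; lra.
  - by move=> u _; rewrite subr_ge0 speed_le.
by move=> oo; rewrite ger0_norm ?subr_ge0//; lra.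
Qed.

(** Continuous extension of X to R; [w] below extends the derivative of omega in the same way. *)
Let Xc t := X (clamp 0 S t).

Let Xc_continuous : continuous Xc.
Proof.
exact: (within_clamp_continuous _ _ _ tau_tilde_ge0 free_path_within_continuous).
Qed.

Let XcE t : 0 <= t <= S -> Xc t = X t.
Proof. by move=> tS; rewrite /Xc clampE. Qed.

Let w t := - y - speed (Xc t).

Let w_continuous : continuous w.
Proof.
move=> t; apply: cvgB; first exact: cvg_cst.
by apply: continuous_comp; [exact: Xc_continuous|exact: speed_continuous].
Qed.

Let cw2_continuous : continuous (fun t => c * w t ^+ 2).
Proof.
move=> t; apply: cvgMr; apply: (continuous_comp (f := w) (g := fun z => z ^+ 2)).
  exact: w_continuous.
exact: exprn_continuous.
Qed.

(** c1 (c/c1)^2 + c2 (c/c2)^2 = c, so psi pays c times the square of the derivative of omega: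
    splitting omega this way makes Young's inequality an equality. *)
Lemma action_free_path T : 0 <= T -> T <= S ->
  action c1 c2 T psi = (\int[mu]_(t in `[0%R, T]) (c * w t ^+ 2)%:E)%E.
Proof.
move=> T0 TS.
have inS t : 0 <= t <= T -> 0 <= t <= S by move=> /andP[-> /le_trans->].
have ac f a : (forall t, 0 <= t <= S -> f t = a * omega t) ->
    absolutely_continuous T f.
  move=> fE; apply: (absolutely_continuous_lipschitz f (`|a| * - y) _
    (absolutely_continuous_id T)) => s t sT tT /=.
  rewrite !fE ?inS// -mulrBr normrM -mulrA ler_wpM2l//.
  by apply: omega_lipschitz; exact: inS.
rewrite /action asboolT; last first.
  split; [apply: (ac _ (c / c1)) => t /psiE[]//|].
  by apply: (ac _ (- (c / c2))) => t /psiE[_ ->]; rewrite mulNr.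
have d f a t : (forall s, 0 <= s <= S -> f s = a * omega s) -> 0 < t < T ->
    derive1 f t = a * w t.
  move=> fE /andP[t0 tT].
  have tS : t < S by exact: lt_le_trans TS.
  have dom : is_derive t 1 omega (- y - speed (X t)).
    by apply: free_path_rate; rewrite t0.
  have da : is_derive t 1 (a \*: omega) (a *: (- y - speed (X t))) by exact: is_deriveZ.
  have df : is_derive t 1 f (a *: (- y - speed (X t))).
    apply: near_eq_is_derive da; near=> s; rewrite fE//; apply/andP; split.
      by apply/ltW; near: s; exact: lt_nbhsr.
    by apply/ltW; near: s; exact: lt_nbhsl.
  by rewrite derive1E derive_val /w XcE// !ltW.
(* The integrands are compared on the open interval only: [derive1] is a two-sided derivative, which
   psi need not have at the end points. *)
have mw : measurable_fun `]0, T[%classic (fun t => c * w t ^+ 2).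
  by apply: measurable_funTS; apply: continuous_measurable_fun; exact: cw2_continuous.
have E : {in `]0, T[%classic, (fun t => c * w t ^+ 2) =1
    (fun s => c1 * derive1 psi.1 s ^+ 2 + c2 * derive1 psi.2 s ^+ 2)}.
  move=> t; rewrite inE/= in_itv/= => tT.
  rewrite (d _ (c / c1))//; last by move=> s /psiE[].
  rewrite (d _ (- (c / c2)))//; last by move=> s /psiE[_ ->]; rewrite mulNr.
  have cc : c1^-1 + c2^-1 = c^-1 by rewrite /cpar invrK.
  have -> : c1 * (c / c1 * w t) ^+ 2 + c2 * (- (c / c2) * w t) ^+ 2 =
    c ^+ 2 * (c1^-1 + c2^-1) * w t ^+ 2 by field; rewrite !gt_eqF.
  by rewrite cc expr2 mulfK.
apply: eq_integral_itv_bounded => //.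
- exact: eq_measurable_fun E mw.
- by move=> t tT; rewrite E// inE.
Unshelve. all: by end_near. Qed.

Lemma marginal_is_derive u : 0 < u < x ->
  is_derive u 1 marginal (h1 u / speed u).
Proof.
move=> /andP[u0 ux].
have dh : is_derive u 1 h (h1 u).
  by apply: has_derivative_on_is_derive h' _; rewrite u0; exact: lt_trans x_lt_D.
have dcap : is_derive u 1 capped (h1 u).
  apply: near_eq_is_derive dh; near=> z; rewrite cappedE//; apply/andP; split.
    by apply/ltW; near: z; exact: lt_nbhsr.
  by apply/ltW; near: z; exact: lt_nbhsl.
have din : is_derive u 1 (fun z => y ^+ 2 - capped z / c) (- (h1 u / c)).
  have dcst : is_derive u (1 : R) (cst (y ^+ 2)) (0 : R) by exact: is_derive_cst.
  have dZ : is_derive u 1 (c^-1 \*: capped) (c^-1 *: h1 u) by exact: is_deriveZ.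
  have dB : is_derive u 1 (cst (y ^+ 2) - (c^-1 \*: capped)) (0 - c^-1 *: h1 u).
    exact: is_deriveB.
  rewrite (_ : (fun z => _) = cst (y ^+ 2) - (c^-1 \*: capped)); last first.
    by apply/funext => z; congr (_ - _); exact: mulrC.
  by apply: is_derive_eq dB _; rewrite sub0r [_ *: _]mulrC.
have dspeed : is_derive u 1 speed ((2 * speed u)^-1 * - (h1 u / c)).
  have dsqrt : is_derive (y ^+ 2 - capped u / c) 1 Num.sqrt (2 * speed u)^-1.
    by apply: is_derive1_sqrt; exact: discr_gt0.
  exact: (@is_derive1_comp _ Num.sqrt (fun z => y ^+ 2 - capped z / c) _ _ _ dsqrt din).
have dmarg : is_derive u 1 marginal
    ((2 * c) *: (0 - (2 * speed u)^-1 * - (h1 u / c))).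
  have dcst : is_derive u (1 : R) (cst (- y)) (0 : R) by exact: is_derive_cst.
  exact: (is_deriveZ (2 * c) (is_deriveB dcst dspeed)).
apply: is_derive_eq dmarg _; rewrite [_ *: _]mulrC; field.
by rewrite gt_eqF// speed_gt0.
Unshelve. all: by end_near. Qed.

Let D_ge0 : 0 <= D.
Proof. exact: le_trans (ltW x_lt_D). Qed.

Let hD_continuous : continuous (h \o clamp 0 D).
Proof.
apply: within_clamp_continuous => //.
exact: has_derivative_on_within_continuous h'.
Qed.

Let h1D_continuous : continuous (h1 \o clamp 0 D).
Proof. exact: within_clamp_continuous. Qed.

(** The tangent bound for h at X(t) - p; the clamps make it continuous in t. *)
Let tangent (p t : R) := h (clamp 0 D (Xc t)) - p * h1 (clamp 0 D (Xc t)).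

Let tangent_continuous p : continuous (tangent p).
Proof.
move=> t; apply: cvgB.
  apply: (continuous_comp (f := Xc) (g := h \o clamp 0 D)).
    exact: Xc_continuous.
  exact: hD_continuous.
apply: cvgMr; apply: (continuous_comp (f := Xc) (g := h1 \o clamp 0 D)).
  exact: Xc_continuous.
exact: h1D_continuous.
Qed.

Let tangentE p t : 0 < t < S -> tangent p t = h (X t) - p * h1 (X t).
Proof.
move=> /andP[t0 tS]; rewrite /tangent XcE ?clampE//; last by rewrite !ltW.
by have /andP[X0 Xx] := free_path_itv t (introT andP (conj t0 tS));
  rewrite (ltW X0)/= ltW// (lt_trans Xx).
Qed.

                                                                              
                                             
(** The integrand is the derivative of -V(X) + p marginal(X). With X' = -speed(X), the first term
    contributes marginal(X) speed(X) = h(X) - c omega'^2, and marginal' = h'/speed makes the second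
    contribute -p h'(X). *)
Lemma free_path_payoff p T : 0 <= T -> T <= S ->
  (\int[mu]_(t in `[0%R, T]) (tangent p t - c * w t ^+ 2)%:E =
   (V x - V (X T) + p * (marginal (X T) - marginal x))%:E)%E.
Proof.
move=> T0 TS.
pose N t := - V (X t) + p * marginal (X t).
have NE : V x - V (X T) + p * (marginal (X T) - marginal x) = N T - N 0.
  by rewrite /N free_path0; ring.
have X_ge0 t : 0 <= t <= S -> 0 <= X t.
  move=> /andP[t0 tS]; rewrite -free_path_end free_path_decreasing//.
rewrite NE; apply: continuous_FTC2_is_derive => //.
- apply: continuous_subspaceT => t; apply: cvgB; first exact: tangent_continuous.
  exact: cw2_continuous.
- have cXT := cX 0 T (lexx _) TS.
  have cVX : {within `[0, T], continuous (V \o X)}.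
    apply: within_continuous_comp cXT => _ /set_mem[t /= + <-].
    rewrite in_itv/= => /andP[t0 tT]; apply: V_cont.
    have := X_ge0 t; rewrite t0 (le_trans tT TS) => /(_ isT); lra.
  have cmX : {within `[0, T], continuous (marginal \o X)}.
    by apply: within_continuous_comp cXT => z _; exact: marginal_continuous.
  by move=> t; apply: cvgD; [apply: cvgN; exact: cVX|apply: cvgMr; exact: cmX].
move=> t /andP[t0 tT].
have tS : 0 < t < S by rewrite t0 (lt_le_trans tT).
have /andP[X0 Xx] := free_path_itv t tS.
have dX : is_derive t 1 X (- speed (X t)).
  by apply: free_path_is_derive => //; exact: ltW.
have dV : is_derive t 1 (V \o X) (marginal (X t) * - speed (X t)).
  have dVX : is_derive (X t) 1 V (marginal (X t)) by apply: V'; lra.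
  exact: (is_derive1_comp dVX dX).
have dm : is_derive t 1 (marginal \o X) (h1 (X t) / speed (X t) * - speed (X t)).
  have dmX : is_derive (X t) 1 marginal (h1 (X t) / speed (X t)).
    by apply: marginal_is_derive; rewrite X0.
  exact: (is_derive1_comp dmX dX).
have dN : is_derive t 1 N (- (marginal (X t) * - speed (X t)) +
    p *: (h1 (X t) / speed (X t) * - speed (X t))).
  exact: (is_deriveD (is_deriveN dV) (is_deriveZ p dm)).
apply: is_derive_eq dN _; rewrite tangentE//.
have tS' : 0 <= t <= S by rewrite ltW// ltW// (lt_le_trans tT).
rewrite /w XcE//.
have hX : h (X t) = c * (y ^+ 2 - speed (X t) ^+ 2).
  by rewrite speed_sqr cappedE ?ltW//; field.
have -> : p *: (h1 (X t) / speed (X t) * - speed (X t)) = - (p * h1 (X t)).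
  by rewrite mulrN divfK ?gt_eqF ?speed_gt0// [LHS]mulrN.
by rewrite hX /marginal; ring.
Qed.

Lemma value_le_cost : ((V x)%:E <= cost r c1 c2 y h x psi rho)%E.
Proof.
have [T [tauE T0 TS rhoT]] := hitting_time_free_path.
rewrite /cost tauE/= rhoT (action_free_path T T0 TS).
have [rho_ge0 rho_homo _ _] := rhoP.
set p := X T; have Tin : 0 <= T <= S by rewrite T0.
have p0 : 0 <= p by rewrite /p -rhoT rho_ge0.
have px : p <= x by exact: free_path_le.
have iC (f : R -> R) : continuous f -> mu.-integrable `[0, T] (EFin \o f).
  move=> cf; apply: continuous_compact_integrable; first exact: segment_compact.
  exact: continuous_subspaceT.
have it := iC _ (tangent_continuous p); have iw := iC _ cw2_continuous.
(* What has been pushed by time t is at most the total push p = rho T, and X has not yet gone below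
   p = X T. *)
have phit t : 0 <= t <= T -> X t - p <= phi y x psi rho t <= X t /\ 0 <= X t - p.
  move=> /andP[t0 tT]; rewrite phi_free_path ?t0 ?(le_trans tT)//.
  have := rho_homo t T t0 tT; rewrite rhoT -/p.
  have := rho_ge0 t t0; have := free_path_decreasing t T t0 tT TS; rewrite -/p.
  by lra.
have hle : (\int[mu]_(t in `[0%R, T]) (tangent p t)%:E <=
            \int[mu]_(t in `[0%R, T]) (h (phi y x psi rho t))%:E)%E.
  apply: le_integral_nonneg_ae => //=.
  - move=> t; rewrite in_itv/= => tT; have [/andP[ph1 ph2] ph3] := phit t tT.
    have tS : 0 <= t <= S by case/andP: tT => -> /le_trans->.
    have := free_path_le t tS => Xx; rewrite -h0 h_homo//; lra.
  have ae := ae_filter_ringOfSetsType mu.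
  have /(@filterS _ _ ae) := @filterI _ _ ae _ _ (ae_neq 0) (ae_neq T).
  apply=> t [/eqP t0 /eqP tT]; rewrite /= in_itv/= => t0T.
  have [/andP[ph1 ph2] ph3] := phit t t0T.
  have /andP[t0' tT'] : 0 < t < T.
    by case/andP: t0T => ? ?; rewrite !lt_neqAle eq_sym t0 tT; apply/andP.
  have tS : 0 < t < S by rewrite t0' (lt_le_trans tT').
  have /andP[X0 Xx] := free_path_itv t tS.
  rewrite tangentE//; apply: (@le_trans _ _ (h (X t - p))).
    apply: (convex_tangent_le D) => //; first by apply/ltW/(lt_trans Xx).
    by apply: has_derivative_on_is_derive h' _; rewrite X0; exact: lt_trans x_lt_D.
  by apply: h_homo => //; lra.
have pay := free_path_payoff p T T0 TS.
rewrite integralB_EFin// in pay.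
have fin_t : (\int[mu]_(t in `[0%R, T]) (tangent p t)%:E)%E \is a fin_num.
  exact: integrable_fin_num.
have fin_w : (\int[mu]_(t in `[0%R, T]) (c * w t ^+ 2)%:E)%E \is a fin_num.
  exact: integrable_fin_num.
apply: (@le_trans _ _ (\int[mu]_(t in `[0%R, T]) (tangent p t)%:E + (r * p)%:E -
   \int[mu]_(t in `[0%R, T]) (c * w t ^+ 2)%:E)%E); last first.
  by apply: leeB => //; apply: leeD.
rewrite addeAC pay -EFinD lee_fin -/p.
(* The surplus over V(x) is p marginal(p) - V(p), nonnegative by this tangent inequality, plus p (r
   - marginal(x)), nonnegative by [marginal_le]. *)
have Vp : V p - V 0 <= marginal p * (p - 0).
  apply: value_increment_le => // t /andP[_ tp].
  by apply: marginal_homo; exact: ltW.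
have := ler_wpM2l p0 (marginal_le x); move: Vp; rewrite V0.
lra.
Qed.

End Controlled.
End UncontrolledPath.
End Primitive.

End HamiltonJacobi.

(** beta0 is the zero of h(u) + r y + r^2/(4c) on [0, D], or D if that expression is negative
    throughout; strict monotonicity of h makes it negative to the left of beta0. *)
Lemma lt_beta0 (R : realType) (D r c1 c2 y x : R) (h : R -> R) :
  0 < r -> 0 < c1 -> 0 < c2 -> 0 <= D ->
  {within `[0, D], continuous h} ->
  (forall u v, 0 <= u -> u < v -> v <= D -> h u < h v) -> h 0 = 0 ->
  r / (4 * cpar c1 c2) <= - y ->
  0 <= x -> x < beta0 D r c1 c2 y h ->
  x < D /\ h x + r * y + r ^+ 2 / (4 * cpar c1 c2) < 0.
Proof.
move=> r0 c10 c20 D0 h_cont h_incr h0 y_le x0; rewrite /beta0.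
set q := r ^+ 2 / (4 * cpar c1 c2) + r * y.
have -> : h x + r * y + r ^+ 2 / (4 * cpar c1 c2) = h x + q by rewrite /q; ring.
have q0 : q <= 0.
  rewrite (_ : q = r * (r / (4 * cpar c1 c2) + y)); last by rewrite /q; ring.
  by rewrite pmulr_rle0//; move: y_le; lra.
have hD : h 0 <= h D.
  by move: D0; rewrite le_eqVlt => /predU1P[<-//|D0]; rewrite ltW// h_incr.
case: ifPn => [hDq|]; last first.
  rewrite -ltNge => qhD xD; split => //.
  by have := h_incr x D x0 xD (lexx D); lra.
(* -q is a value of h on [0, D], so the partial inverse in [beta0] returns a genuine preimage in
   [0, D]. *)
have [|b] := IVT D0 h_cont (v := - q).
  by rewrite h0 in hD *; rewrite (min_l hD) (max_r hD) oppr_ge0 q0/= lerNl.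
rewrite -[b \in _]/(b \in `[0, D]) => bD hb.
have bq : (- q) \in [set h x | x in `[0, D]%classic] by rewrite inE; exists b.
have hp := pinvK (fun=> 0) bq.
have : `[0, D]%classic ('pinv_(fun=> 0) `[0, D] h (- q)).
  have hsurj : set_surj `[0, D]%classic [set h z | z in `[0, D]%classic] h by [].
  apply: (surjpinv_image_sub (dflt := fun=> 0) hsurj).
  by exists (- q) => //; exists b.
rewrite /= in_itv/= => /andP[p0 pD] xp; split; first exact: (lt_le_trans xp pD).
by have := h_incr _ _ x0 xp pD; rewrite hp; lra.
Qed.

Theorem proposition3p3 (R : realType) (D r c1 c2 y : R) (h : R -> R)
  (D_gt0 : 0 < D) (r_gt0 : 0 < r) (c1_gt0 : 0 < c1) (c2_gt0 : 0 < c2)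
  (h_cont : {within `[0, D], continuous h})
  (h_incr : forall u v, 0 <= u -> u < v -> v <= D -> h u < h v)
  (h0 : h 0 = 0)
  (y_le : r / (4 * cpar c1 c2) <= - y)
  (h_convex : convex_function (E := R^o) `[0, D]%classic h)
  (h_C2 : C2_on `[0, D] h)
  (x : R) (x_ge0 : 0 <= x) (x_lt : x < beta0 D r c1 c2 y h)
  (omega : R -> R) (omegaP : omega_solution c1 c2 y h x omega)
  (psi : (R -> R) * (R -> R)) (psiP : in_P2 psi)
  (psiE : forall t, 0 <= t <= tau_tilde c1 c2 y h x ->
    psi.1 t = cpar c1 c2 / c1 * omega t /\
    psi.2 t = - (cpar c1 c2 / c2 * omega t))
  (rho : R -> R) (rhoP : in_E rho) (rho_adm : stays_in D y x psi rho) :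
  (tau y x psi rho < +oo)%E /\
  (U D r c1 c2 y h x <= cost r c1 c2 y h x psi rho)%E.
Proof.
have [xD hx] := lt_beta0 _ _ _ _ _ _ _ _ r_gt0 c1_gt0 c2_gt0 (ltW D_gt0) h_cont
  h_incr h0 y_le x_ge0 x_lt.
have [_ omega0 omega'] := omegaP.
have [h1 h' [h2 h1' _]] := h_C2.
have h_homo u v : 0 <= u -> u <= v -> v <= x -> h u <= h v.
  move=> u0; rewrite le_eqVlt => /predU1P[->//|uv] vx.
  by rewrite ltW// h_incr// (le_trans vx)// ltW.
have h_contx : {within `[0, x], continuous h}.
  apply: continuous_subspaceW h_cont => u /=; rewrite !in_itv/=.
  by move=> /andP[-> /le_trans->]//; exact: ltW.
have h1_cont := has_derivative_on_within_continuous _ _ _ _ h1'.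
(* [V] is the candidate value that separates [U] from the cost. *)
have [V V0 V'] := continuous_primitive _ (marginal_continuous c1 c2 y x h x_ge0 h_contx).
split.
  have [T [-> _ _ _]] := hitting_time_free_path r c1 c2 y x h c1_gt0 c2_gt0
    x_ge0 h0 h_homo h_contx hx omega omega0 omega' D psi rho psiP psiE rhoP rho_adm.
  exact: ltry.
apply: (@le_trans _ _ (V x)%:E).
  by apply: (value_ge_U r c1 c2 y x h) => //; exact: ltW.
exact: (value_le_cost r c1 c2 y x h r_gt0 c1_gt0 c2_gt0 x_ge0 h0 h_homo h_contx
  y_le hx V V0 V' omega omega0 omega' D h1 psi rho xD h' h1_cont h_convex psiP
  psiE rhoP rho_adm).
Qed.
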